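(* Let $\Gamma$ be a countable abelian semigroup and $\mathcal A$ a countable abelian group with a coloring map $\theta$, such that every element of $\Gamma\times\mathcal A$ can be written as a sum of elements of $\Gamma\times\mathcal A$ in only finitely many ways. Let $\mathfrak L=\bigoplus_{(\alpha,a)\in\Gamma\times\mathcal A}\mathfrak L_{(\alpha,a)}$ be a $(\Gamma\times\mathcal A)$-graded $\theta$-colored Lie superalgebra over $\mathbb C$ with $\dim\mathfrak L_{(\alpha,a)}<\infty$ for all $(\alpha,a)$, and let a group $G$ act on $\mathfrak L$ by Lie superalgebra automorphisms preserving the $(\Gamma\times\mathcal A)$-gradation. Then for all $g\in G$ and $(\alpha,a)\in\Gamma\times\mathcal A$, $$\mathrm{str}(g|\mathfrak L_{(\alpha,a)})=\sum_{\substack{d>0\\(\alpha,a)=d(\tau,b)}}\frac1d\,\mu(d)\,W_{g^d}(\tau,b),$$ where the sum is over all pairs consisting of a positive integer $d$ and $(\tau,b)\in\Gamma\times\mathcal A$ with $d(\tau,b)=(\alpha,a)$, $\mu$ is the classical Möbius function, and $W_g$ is the Witt partition function.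
   Context: Coloring map: $\theta:\mathcal A\times\mathcal A\to\mathbb C^\times$ with $\theta(a+b,c)=\theta(a,c)\theta(b,c)$, $\theta(a,b+c)=\theta(a,b)\theta(a,c)$, $\theta(a,b)\theta(b,a)=1$. The sign map is $\psi(a)=\theta(a,a)\in\{\pm1\}$ (a group homomorphism); $a$ is even if $\psi(a)=1$ and odd if $\psi(a)=-1$. A $(\Gamma\times\mathcal A)$-graded $\theta$-colored Lie superalgebra is a graded space with a bilinear bracket satisfying $[\mathfrak L_{(\alpha,a)},\mathfrak L_{(\beta,b)}]\subset\mathfrak L_{(\alpha+\beta,a+b)}$, $[x,y]=-\theta(a,b)[y,x]$ and $[x,[y,z]]=[[x,y],z]+\theta(a,b)[y,[x,z]]$ for $x\in\mathfrak L_{(\alpha,a)}$, $y\in\mathfrak L_{(\beta,b)}$, $z\in\mathfrak L$. Its universal enveloping algebra $U(\mathfrak L)$ is the quotient of the tensor algebra by the relations $[x,y]=xy-\theta(a,b)yx$. Supertrace: if $G$ acts on a finite-dimensional homogeneous space $V_{(\alpha,a)}$, then $\mathrm{str}(g|V_{(\alpha,a)})=\psi(a)\,\mathrm{tr}(g|V_{(\alpha,a)})$. Homology: $H_k(\mathfrak L)=\mathrm{Tor}^{U(\mathfrak L)}_k(\mathbb C,\mathbb C)$ ($\mathbb C$ trivial); it is the homology of the standard complex with terms $C_k(\mathfrak L)=\bigoplus_{p+q=k}\Lambda^p(\mathfrak L_0)\otimes S^q(\mathfrak L_1)$, where $\mathfrak L_0,\mathfrak L_1$ are the sums of the even, resp.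 odd, homogeneous components, and it inherits the $(\Gamma\times\mathcal A)$-gradation and the $G$-action. $H(\mathfrak L)=\sum_{k\ge1}(-1)^{k+1}H_k(\mathfrak L)$ is the alternating direct sum, i.e. $\mathrm{str}(g|H(\mathfrak L)_{(\alpha,a)})=\sum_{k\ge1}(-1)^{k+1}\mathrm{str}(g|H_k(\mathfrak L)_{(\alpha,a)})$ (a finite sum). Witt partition function: for $g\in G$ let $P=\{(\alpha,a)\in\Gamma\times\mathcal A:\mathrm{str}(g|H(\mathfrak L)_{(\alpha,a)})\ne0\}$, enumerated as $\{(\alpha_i,a_j)\}$. For $(\tau,b)\in\Gamma\times\mathcal A$ let $T(\tau,b)$ be the set of families $s=(s_{ij})$ of nonnegative integers with $\sum_{i,j}s_{ij}(\alpha_i,a_j)=(\tau,b)$ (partitions of $(\tau,b)$ into elements of $P$), and put $|s|=\sum s_{ij}$, $s!=\prod s_{ij}!$, $$W_g(\tau,b)=\sum_{s\in T(\tau,b)}\frac{(|s|-1)!}{s!}\prod_{i,j}\mathrm{str}(g|H(\mathfrak L)_{(\alpha_i,a_j)})^{s_{ij}}.$$ *)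

(* Defs.v *)
From HB Require Import structures.
From mathcomp Require Import all_boot all_order all_algebra.
From mathcomp Require Import finmap multiset freeg.
From mathcomp Require Import boolp classical_sets functions cardinality fsbigop.

Set Implicit Arguments.
Unset Strict Implicit.
Unset Printing Implicit Defensive.

Import GRing.Theory.
Local Open Scope classical_set_scope.
Local Open Scope ring_scope.

(* Sums in a semigroup, which need not have a zero: the empty sum is None. *)
Definition semisum (S : addSemigroupType) (s : seq S) : option S :=
  foldr (fun x o => Some (oapp (+%R x) x o)) None s.

(* d x = x + ... + x (d times); only meaningful for 0 < d. *)
Definition semimul (S : addSemigroupType) (d : nat) (x : S) : S :=
  iter d.-1 (+%R x) x.

(* Ordered expressions are used: an unordered expression has only finitely
   many orderings, so finiteness does not depend on this choice. *)
Definition finitely_decomposable (S : addSemigroupType) : Prop :=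
  forall x : S, finite_set [set s : seq S | semisum s = Some x].

Definition mobius (n : nat) : int :=
  if all (fun p => logn p n == 1%N) (primes n) then (-1) ^+ size (primes n)
  else 0.

Section LinearAlgebra.
Context {F : fieldType} {V : lmodType F}.

Definition submodule (X : set V) : Prop :=
  X 0 /\ forall (c : F) (u v : V), X u -> X v -> X (c *: u + v).

Definition span (X : set V) : set V := smallest submodule X.

Definition finite_dimensional (X : set V) : Prop :=
  exists s : seq V, X = span [set` s].

(* t is the trace of the endomorphism induced by f on the quotient Z / B:
   M is the matrix of that endomorphism in the basis of the classes of the
   vectors z i. *)
Definition is_trace (Z B : set V) (f : V -> V) (t : F) : Prop :=
  exists n (z : 'I_n -> V) (M : 'M[F]_n),
    [/\ forall i, Z (z i),
        forall v, Z v -> exists! c : 'rV[F]_n, B (v - \sum_i c 0 i *: z i),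
        forall i, B (f (z i) - \sum_j M i j *: z j)
      & t = \tr M].

Definition trace (Z B : set V) (f : V -> V) : F := xget 0 (is_trace Z B f).

End LinearAlgebra.

(* The second equation below makes every value of theta nonzero. *)
Record coloring {F : fieldType} {A : zmodType} (theta : A -> A -> F) : Prop := {
  coloringDl : forall a b c, theta (a + b) c = theta a c * theta b c;
  coloringDr : forall a b c, theta a (b + c) = theta a b * theta a c;
  coloring_skew : forall a b, theta a b * theta b a = 1
}.

Section ColorLie.
Context {F : fieldType} {Gamma : addSemigroupType} {A : zmodType}.
Variable theta : A -> A -> F.

Local Notation degree := (Gamma * A)%type.

Definition psi (a : A) : F := theta a a.

(* Lc x is the homogeneous component of degree x, and L is their direct sum. *)
Definition is_grading (L : lmodType F) (Lc : degree -> set L) : Prop :=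
  (forall x, submodule (Lc x)) /\
  (forall v : L, exists! f : degree -> L,
     [/\ forall x, Lc x (f x), finite_set [set x | f x != 0]
       & v = \sum_(x \in [set: degree]) f x]).

Record color_lie_superalgebra (L : lmodType F) (Lc : degree -> set L)
    (br : L -> L -> L) : Prop := {
  color_lie_grading : is_grading Lc;
  color_lie_graded : forall x y u v,
    Lc x u -> Lc y v -> Lc (x + y) (br u v);
  color_lie_skew : forall x y u v,
    Lc x u -> Lc y v -> br u v = - (theta x.2 y.2 *: br v u);
  color_lie_jacobi : forall x y u v w,
    Lc x u -> Lc y v ->
    br u (br v w) = br (br u v) w + theta x.2 y.2 *: br v (br u w)
}.

Record graded_action (L : lmodType F) (Lc : degree -> set L)
    (br : L -> L -> L) (G : groupType) (rho : G -> L -> L) : Prop := {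
  action1 : forall u, rho 1%g u = u;
  actionM : forall g h u, rho (g * h)%g u = rho g (rho h u);
  action_bracket : forall g u v, rho g (br u v) = br (rho g u) (rho g v);
  action_graded : forall g x u, Lc x u -> Lc x (rho g u)
}.

(* Supertrace of f on the homogeneous space Z / B of degree x. *)
Definition str (V : lmodType F) (x : degree) (Z B : set V) (f : V -> V) : F :=
  psi x.2 * trace Z B f.

Section Homology.
Variables (L : lmodType F) (Lc : degree -> set L) (br : L -> L -> L).

(* A letter (x, u) stands for the element u of Lc x; the word
   (x_1, u_1) ... (x_k, u_k) stands for u_1 /\ ... /\ u_k.  Words that are
   not homogeneous in the sense of hword below belong to no chain space. *)
Local Notation letter := (degree * L)%type.
Local Notation word := (seq letter).
Local Notation words := {freeg word / F}.

Definition wd (w : word) : words := Freeg [:: (1, w)].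

Definition hword (k : nat) (x : degree) (w : word) : Prop :=
  [/\ size w = k, semisum [seq p.1 | p <- w] = Some x
    & forall p, p \in w -> Lc p.1 p.2].

Definition chains (k : nat) (x : degree) : set words :=
  span [set c | exists2 w, hword k x w & c = wd w].

(* Multilinearity, and u /\ v = - theta(a, b) v /\ u for u, v of colors a, b.
   Hence chains / relations is the degree x component of C_k(L): even letters
   can be moved to the left of odd ones, and since theta(a, a) is 1 for a even
   and -1 for a odd, what remains are the (colored) exterior powers of the
   even part tensored with the (colored) symmetric powers of the odd part. *)
Definition relations (k : nat) (x : degree) : set words :=
  span (
    [set r | exists w1 w2 y c u v,
       [/\ hword k x (w1 ++ (y, u) :: w2), Lc y v
         & r = wd (w1 ++ (y, c *: u + v) :: w2)
               - c *: wd (w1 ++ (y, u) :: w2) - wd (w1 ++ (y, v) :: w2)]]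
    `|`
    [set r | exists w1 w2 p q,
       hword k x (w1 ++ p :: q :: w2) /\
       r = wd (w1 ++ p :: q :: w2)
           + theta p.1.2 q.1.2 *: wd (w1 ++ q :: p :: w2)]).

Definition lbr (p q : letter) : letter := (p.1 + q.1, br p.2 q.2).

Definition wedge (p : letter) : words -> words :=
  fglift (fun w => wd (p :: w)).

(* Colored derivation w |-> p . w extending the adjoint action of p. *)
Fixpoint adjoint (p : letter) (w : word) : words :=
  if w is q :: w' then
    wd (lbr p q :: w') + theta p.1.2 q.1.2 *: wedge q (adjoint p w')
  else 0.

(* d(p /\ w) = p . w - p /\ d w.  Unfolded, d(u_1 /\ ... /\ u_k) is the sum
   over i < j of (-1)^(i+1) theta(a_i, a_(i+1) + ... + a_(j-1)) times
   u_1 /\ ... /\ u_k with u_i deleted and u_j replaced by [u_i, u_j]; for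
   trivial theta this is the Chevalley-Eilenberg differential. *)
Fixpoint diff_word (w : word) : words :=
  if w is p :: w' then adjoint p w' - wedge p (diff_word w') else 0.

Definition diff : words -> words := fglift diff_word.

Definition cycles (k : nat) (x : degree) : set words :=
  [set c | chains k x c /\ relations k.-1 x (diff c)].

Definition boundaries (k : nat) (x : degree) : set words :=
  [set b | exists2 c, chains k.+1 x c & relations k x (b - diff c)].

Definition chain_map (f : L -> L) : words -> words :=
  fglift (fun w => wd [seq (p.1, f p.2) | p <- w]).

(* Supertrace on the degree x component of H_k(L) = cycles / boundaries, the
   homology of the standard complex, which computes Tor^{U(L)}_k(F, F).  Only
   k >= 1 is meaningful; degrees in Gamma x A never occur in C_0(L) = F. *)
Definition str_homology_k (f : L -> L) (k : nat) (x : degree) : F :=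
  str x (cycles k x) (boundaries k x) (chain_map f).

(* Almost all terms vanish when degree is finitely decomposable. *)
Definition str_homology (f : L -> L) (x : degree) : F :=
  \sum_(k \in [set k | (1 <= k)%N]) (-1) ^+ k.+1 * str_homology_k f k x.

End Homology.

(* Partitions of x into elements of the support of h, encoded as multisets. *)
Definition partitions (h : degree -> F) (x : degree) :
    set (multiset degree) :=
  [set s | (forall y, y \in finsupp s -> h y != 0)
           /\ semisum (enum_mset s) = Some x].

Definition witt_partition (h : degree -> F) (x : degree) : F :=
  \sum_(s \in partitions h x)
     ((size (enum_mset s)).-1)`!%:R
       / (\prod_(y <- finsupp s) (s y)`!)%:R
     * \prod_(y <- finsupp s) h y ^+ s y.

(* W_g for the group element g acting on L by f. *)
Definition witt (L : lmodType F) (Lc : degree -> set L) (br : L -> L -> L)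
    (f : L -> L) : degree -> F :=
  witt_partition (str_homology Lc br f).

End ColorLie.

(* Main.v *)
(* The supertraces of g on the chain spaces of the standard complex are those
   on its homology by the Euler-Poincare principle.  If g acts triangularly with
   eigenvalues lam_i on basis vectors of degrees deg_i, then the chain spaces
   have bases of monomials on which g is again triangular, and the alternating
   sum of the supertraces is the product of the (1 - lam_i E^deg_i)^(+-1).  So
   1 - sum_x str(g | H_x) E^x equals this product; taking -log of both sides
   identifies W_g(x) with the sum of str(g^d | L_y) / d over d y = x, and
   Moebius inversion concludes.  To take logarithms of formal series over a
   semigroup, a variable 'X marking the number of factors is introduced, and
   logarithmic derivatives are compared modulo 'X^n. *)

From HB Require Import structures.
From mathcomp Require Import all_boot all_order all_algebra.
From mathcomp Require Import finmap multiset freeg.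
From mathcomp Require Import boolp classical_sets functions cardinality fsbigop.
From mathcomp Require Import reals complex.
From mathcomp Require Import ring zify.
Require Import Defs.

Set Implicit Arguments.
Unset Strict Implicit.
Unset Printing Implicit Defensive.

Import Order.TTheory GRing.Theory Num.Theory.
Local Open Scope classical_set_scope.
Local Open Scope ring_scope.

(** * Traces on subquotients *)

(** Everything is done around one fixed degree [x]. Finite decomposability bounds the length of the
    words of degree [x] by some [n] and confines their letters to a finite set [D]; bases are chosen
    only in the components with degree in [D], which makes the Euler product finite. An element of
    an arbitrary group need not act diagonalizably. Over an algebraically closed field it is
    triangular in some basis, and this basis serves all its powers, with diagonal entries
    [lam i ^+ d]. So the power sums of the [lam i] that the logarithm produces are the supertraces
    of the powers of [g]. The chain spaces are quotients of spans of words, and the independence of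
    the monomials has to be proved. It comes from functionals that kill the relations and read off a
    single monomial up to a nonzero factor. Since the formula for [g] involves all its powers, the
    inversion is carried out for the family of all [g ^+ m] at once. *)

Section Submodules.
Context {F : fieldType} {V : lmodType F}.
Implicit Types (X B Z : set V) (u v w : V).

Lemma span_submodule X : submodule (span X).
Proof.
split; first by move=> M [[M0 _] _].
move=> c u v hu hv M hM; move: (hM) => -[[_ Ml] _].
by apply: Ml; [apply: hu | apply: hv].
Qed.

Lemma sub_span X : X `<=` span X.
Proof. exact: sub_gen_smallest. Qed.

Lemma span_subP X B : submodule B -> X `<=` B -> span X `<=` B.
Proof. by move=> hB hX; apply: smallest_sub. Qed.

Variables (B : set V) (hB : submodule B).

Lemma submodule0 : B 0. Proof. by case: hB. Qed.

Lemma submoduleZ c u : B u -> B (c *: u).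
Proof.
by case: hB => b0 bl hu; rewrite -[_ *: _]addr0; apply: bl.
Qed.

Lemma submoduleD u v : B u -> B v -> B (u + v).
Proof. by case: hB => b0 bl hu hv; rewrite -[u]scale1r; apply: bl. Qed.

Lemma submoduleN u : B u -> B (- u).
Proof. by move=> hu; rewrite -scaleN1r; apply: submoduleZ. Qed.

Lemma submoduleB u v : B u -> B v -> B (u - v).
Proof. by move=> hu hv; apply: submoduleD => //; apply: submoduleN. Qed.

Lemma submodule_sum (I : Type) (r : seq I) (P : pred I) (f : I -> V) :
  (forall i, P i -> B (f i)) -> B (\sum_(i <- r | P i) f i).
Proof.
by move=> h; elim/big_ind: _ => //; [apply: submodule0 | apply: submoduleD].
Qed.

Lemma submodule_trans u v w : B (u - v) -> B (v - w) -> B (u - w).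
Proof.
by move=> h1 h2; rewrite -[u](subrK v) -addrA; apply: submoduleD.
Qed.

Lemma submodule_sym u v : B (u - v) -> B (v - u).
Proof. by move=> h; rewrite -opprB; apply: submoduleN. Qed.

Lemma submodule_refl u : B (u - u).
Proof. by rewrite subrr; apply: submodule0. Qed.

Lemma submodule_subr u v : B v -> B u <-> B (u - v).
Proof.
move=> hv; split=> hu; first exact: submoduleB.
by rewrite -(subrK v u); apply: submoduleD.
Qed.

End Submodules.

Lemma submodule_preimage (F : fieldType) (V W : lmodType F)
    (f : {linear V -> W}) (B : set W) :
  submodule B -> submodule (f @^-1` B).
Proof.
move=> hB; split => [|c u v hu hv]; rewrite /preimage /=.
  by rewrite linear0; apply: submodule0.
by rewrite linearP; case: hB => _; apply.
Qed.

Lemma submoduleI (F : fieldType) (V : lmodType F) (B C : set V) :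
  submodule B -> submodule C -> submodule (B `&` C).
Proof.
move=> [b0 bl] [c0 cl]; split=> // c u v [hu1 hu2] [hv1 hv2].
by split; [apply: bl | apply: cl].
Qed.

Lemma submodule_set0 (F : fieldType) (V : lmodType F) :
  submodule ([set 0] : set V).
Proof. by split=> // c u v -> ->; rewrite scaler0 addr0. Qed.

Section LinearCombinations.
Context {F : fieldType} {V : lmodType F}.

Definition lincomb n (c : 'rV[F]_n) (z : 'I_n -> V) := \sum_i c 0 i *: z i.

Lemma lincombP n (z : 'I_n -> V) a c d :
  lincomb (a *: c + d) z = a *: lincomb c z + lincomb d z.
Proof.
rewrite /lincomb scaler_sumr -big_split /=.
by apply: eq_bigr => i _; rewrite !mxE scalerDl scalerA.
Qed.

Lemma lincombZ n (z : 'I_n -> V) a c : lincomb (a *: c) z = a *: lincomb c z.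
Proof.
rewrite /lincomb scaler_sumr; apply: eq_bigr => i _.
by rewrite mxE scalerA.
Qed.

Lemma lincombB n (z : 'I_n -> V) c d :
  lincomb (c - d) z = lincomb c z - lincomb d z.
Proof. by rewrite [c - d]addrC -[- d]scaleN1r lincombP scaleN1r addrC.
Qed.

Lemma lincomb0 n (z : 'I_n -> V) : lincomb 0 z = 0.
Proof. by rewrite /lincomb big1 // => i _; rewrite mxE scale0r. Qed.

Lemma lincomb_delta n (z : 'I_n -> V) i : lincomb (delta_mx 0 i) z = z i.
Proof.
rewrite /lincomb (bigD1 i) //= mxE !eqxx scale1r big1 ?addr0 // => j ji.
by rewrite mxE eqxx (negbTE ji) scale0r.
Qed.

(** With coordinates as row vectors, substituting generators modulo [B] is right multiplication by a
    matrix. Changes of basis and matrices of endomorphisms are both handled through this. *)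
Lemma lincomb_mul (B : set V) n m (z : 'I_n -> V) (w : 'I_m -> V)
    (P : 'M[F]_(n, m)) (c : 'rV[F]_n) : submodule B ->
  (forall i, B (z i - lincomb (row i P) w)) ->
  B (lincomb c z - lincomb (c *m P) w).
Proof.
move=> hB h.
have -> : lincomb (c *m P) w = \sum_i c 0 i *: lincomb (row i P) w.
  rewrite /lincomb; under [RHS]eq_bigr do rewrite scaler_sumr.
  rewrite exchange_big /=; apply: eq_bigr => j _.
  rewrite mxE scaler_suml; apply: eq_bigr => i _.
  by rewrite mxE scalerA.
rewrite -sumrB; apply: submodule_sum => // i _.
by rewrite -scalerBr; apply: submoduleZ.
Qed.

End LinearCombinations.

Lemma lincomb_linear (F : fieldType) (V W : lmodType F) (f : {linear V -> W})
    n (c : 'rV[F]_n) (z : 'I_n -> V) :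
  f (lincomb c z) = lincomb c (fun i => f (z i)).
Proof.
by rewrite /lincomb linear_sum; apply: eq_bigr => i _; rewrite linearZ.
Qed.

Section Subquotients.
Context {F : fieldType} {V : lmodType F}.
Implicit Types (X B Z : set V) (u v w : V).

Definition quotient_basis Z B n (z : 'I_n -> V) :=
  (forall i, Z (z i)) /\
  forall v, Z v -> exists! c : 'rV[F]_n, B (v - lincomb c z).

Definition quotient_free B n (z : 'I_n -> V) :=
  forall c : 'rV[F]_n, B (lincomb c z) -> c = 0.

(* The spanning vectors need not lie in Z, so that the property passes to
   submodules of Z. *)
Definition quotient_fin Z B :=
  exists n (z : 'I_n -> V), forall v, Z v ->
    exists c : 'rV[F]_n, B (v - lincomb c z).

Lemma quotient_basis_free Z B n (z : 'I_n -> V) : submodule Z -> submodule B ->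
  quotient_basis Z B z -> quotient_free B z.
Proof.
move=> hZ hB [hz hu] c hc.
have Zc : Z (lincomb c z).
  by apply: submodule_sum => // i _; apply: submoduleZ.
have [c0 [h0 h1]] := hu _ Zc.
rewrite -(h1 c); last exact: submodule_refl.
by apply: h1; rewrite lincomb0 subr0.
Qed.

Lemma quotient_freeP Z B n (z : 'I_n -> V) : submodule B ->
  quotient_free B z -> (forall i, Z (z i)) ->
  (forall v, Z v -> exists c : 'rV[F]_n, B (v - lincomb c z)) ->
  quotient_basis Z B z.
Proof.
move=> hB hf hz hs; split=> // v /hs [c hc]; exists c; split=> // d hd.
apply/eqP; rewrite -subr_eq0; apply/eqP; apply: hf.
rewrite lincombB; apply: (submodule_trans hB (v := v)) => //.
exact: (submodule_sym hB).
Qed.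

(** Steinitz bound modulo [B]: a row of the kernel of the coordinate matrix gives a combination of
    the [z i] lying in [B], hence is zero. So the matrix has full row rank. *)
Lemma quotient_free_le B n m (w : 'I_n -> V) (z : 'I_m -> V) :
  submodule B -> quotient_free B z ->
  (forall i, exists c : 'rV[F]_n, B (z i - lincomb c w)) -> (m <= n)%N.
Proof.
move=> hB hf /choice [C hC].
pose P := \matrix_(i < m) C i.
have h c : B (lincomb c z - lincomb (c *m P) w).
  by apply: lincomb_mul => // i; rewrite rowK.
have : row_free P.
  rewrite -kermx_eq0; apply/eqP/row_matrixP => i; rewrite row0.
  apply: hf; have := h (row i (kermx P)).
  rewrite -row_mul mulmx_ker row0 {2}/lincomb big1 ?subr0 //.
  by move=> j _; rewrite mxE scale0r.
by rewrite /row_free => /eqP <-; apply: rank_leq_col.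
Qed.

(** A free family in [Z] of maximal size is a basis; the spanning vectors, possibly outside [Z],
    bound the sizes. *)
Lemma quotient_basis_ex Z B : submodule Z -> submodule B -> quotient_fin Z B ->
  exists n (z : 'I_n -> V), quotient_basis Z B z.
Proof.
move=> hZ hB [n [w hw]].
pose P m := `[< exists z : 'I_m -> V, (forall i, Z (z i)) /\ quotient_free B z >].
have P0 : exists m, P m.
  exists 0%N; apply/asboolP; exists (fun=> 0); split=> [[]//|c _].
  by apply/rowP => -[].
have Pn m : P m -> (m <= n)%N.
  move=> /asboolP [z [hz hf]]; apply: (quotient_free_le (w := w) hB hf) => i.
  by apply: hw; apply: hz.
case: (ex_maxnP P0 Pn) => m /asboolP [z [hz hf]] hmax.
exists m, z; apply: quotient_freeP => // v hv.
(* By maximality, [v] put in front of [z] satisfies a nontrivial relation modulo [B]. Its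
   coefficient on [v] is nonzero because [z] is free, so one can solve for [v]. *)
pose z' (i : 'I_m.+1) := oapp z v (unlift ord0 i).
have : ~ quotient_free B z'.
  move=> hf'; suff /hmax : P m.+1 by rewrite ltnn.
  apply/asboolP; exists z'; split=> // i; rewrite /z'.
  by case: unliftP => [j|] _ /=.
move=> /existsNP [c /not_implyP [hc /eqP c0]].
have {}hc : B (c 0 ord0 *: v + lincomb (\row_i c 0 (fintype.lift ord0 i)) z).
  move: hc; rewrite /lincomb big_ord_recl {1}/z' unlift_none /=.
  by under eq_bigr do rewrite /z' liftK /=; under [in X in _ -> X]eq_bigr do rewrite mxE.
have d0 : c 0 ord0 != 0.
  apply: contra c0 => /eqP d0; move: hc; rewrite d0 scale0r add0r => /hf h.
  apply/eqP/rowP => i; rewrite mxE; case: (unliftP ord0 i) => [j|] ->//.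
  by move/rowP: h => /(_ j); rewrite !mxE.
exists (- (c 0 ord0)^-1 *: \row_i c 0 (fintype.lift ord0 i)).
rewrite lincombZ scaleNr opprK.
have := submoduleZ hB (c 0 ord0)^-1 hc.
by rewrite scalerDr scalerA mulVf // scale1r.
Qed.

Lemma is_traceE Z B f t : is_trace Z B f t <->
  exists n (z : 'I_n -> V) (M : 'M[F]_n), [/\ quotient_basis Z B z,
    forall i, B (f (z i) - lincomb (row i M) z) & t = \tr M].
Proof.
have rowE n (M : 'M[F]_n) i (z : 'I_n -> V) :
  lincomb (row i M) z = \sum_j M i j *: z j.
  by rewrite /lincomb; apply: eq_bigr => j _; rewrite mxE.
split=> -[n [z [M]]].
  by move=> [h1 h2 h3 ->]; exists n, z, M; split=> // i; rewrite rowE.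
by move=> [[h1 h2] h3 ->]; exists n, z, M; split=> // i; rewrite -rowE.
Qed.

(** The base changes [P'] and [Q'] between the two bases satisfy [M = P' *m N *m Q'] and
    [Q' *m P' = 1], and the trace is cyclic even for rectangular factors. That [f] preserves [B] is
    what lets it be applied to congruences. *)
Lemma is_trace_uniq Z B (f : {linear V -> V}) t t' :
  submodule Z -> submodule B -> (forall v, B v -> B (f v)) ->
  is_trace Z B f t -> is_trace Z B f t' -> t = t'.
Proof.
move=> hZ hB hfB /is_traceE [n [z [M [hz hM ->]]]].
move=> /is_traceE [m [w [N [hw hN ->]]]].
have /choice [P hP] : forall i, exists c : 'rV[F]_m, B (z i - lincomb c w).
  by move=> i; have [c [hc _]] := hw.2 _ (hz.1 i); exists c.
have /choice [Q hQ] : forall i, exists c : 'rV[F]_n, B (w i - lincomb c z).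
  by move=> i; have [c [hc _]] := hz.2 _ (hw.1 i); exists c.
pose P' := \matrix_(i < n) P i; pose Q' := \matrix_(i < m) Q i.
have cP c : B (lincomb c z - lincomb (c *m P') w).
  by apply: lincomb_mul => // i; rewrite rowK.
have cQ c : B (lincomb c w - lincomb (c *m Q') z).
  by apply: lincomb_mul => // i; rewrite rowK.
have freeE k (e : 'I_k -> V) (c d : 'rV[F]_k) :
    quotient_free B e -> B (lincomb c e - lincomb d e) -> c = d.
  by move=> he h; apply/eqP; rewrite -subr_eq0; apply/eqP/he; rewrite lincombB.
have PQ : Q' *m P' = 1%:M.
  apply/row_matrixP => i; rewrite rowE row1 mulmxA.
  apply: freeE (quotient_basis_free hZ hB hw) _.
  apply: (submodule_sym hB); apply: (submodule_trans hB (cQ _)); exact: cP.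
have MN : M = P' *m N *m Q'.
  apply/row_matrixP => i; rewrite [RHS]rowE.
  apply: freeE (quotient_basis_free hZ hB hz) _.
  apply: (submodule_trans hB (submodule_sym hB (hM i))).
  apply: (submodule_trans hB (v := f (lincomb (P i) w))).
    by rewrite -linearB; apply: hfB; apply: hP.
  rewrite lincomb_linear.
  apply: (submodule_trans hB (v := lincomb (P i *m N) w)).
    by apply: lincomb_mul.
  apply: (submodule_trans hB (cQ _)).
  rewrite !mulmxA -rowE rowK.
  exact: submodule_refl.
by rewrite MN -mulmxA mxtrace_mulC -mulmxA PQ mulmx1.
Qed.

Lemma is_trace_ex Z B (f : V -> V) : submodule Z -> submodule B ->
  (forall v, Z v -> Z (f v)) -> quotient_fin Z B -> exists t, is_trace Z B f t.
Proof.
move=> hZ hB hf /(quotient_basis_ex hZ hB) [n [z hz]].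
have /choice [M hM] : forall i, exists c : 'rV[F]_n, B (f (z i) - lincomb c z).
  by move=> i; have [c [hc _]] := hz.2 _ (hf _ (hz.1 i)); exists c.
exists (\tr (\matrix_i M i)); apply/is_traceE; exists n, z, (\matrix_i M i).
by split=> // i; rewrite rowK.
Qed.

Lemma traceP Z B (f : V -> V) : submodule Z -> submodule B ->
  (forall v, Z v -> Z (f v)) -> quotient_fin Z B ->
  is_trace Z B f (trace Z B f).
Proof.
move=> hZ hB hf hfin; have [t ht] := is_trace_ex hZ hB hf hfin.
by rewrite /trace; apply: xgetPex; exists t.
Qed.

(** [trace] is a choice made by [xget]; uniqueness ties it to any value computed in a particular
    basis. *)
Lemma is_trace_trace Z B (f : {linear V -> V}) t :
  submodule Z -> submodule B -> (forall v, B v -> B (f v)) ->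
  is_trace Z B f t -> trace Z B f = t.
Proof.
move=> hZ hB hfB ht; apply: (is_trace_uniq hZ hB hfB _ ht).
by rewrite /trace; apply: xgetPex; exists t.
Qed.

Lemma quotient_fin_sub Z Z' B B' : Z' `<=` Z -> B `<=` B' ->
  quotient_fin Z B -> quotient_fin Z' B'.
Proof.
move=> hZ hB [n [z h]]; exists n, z => v /hZ /h [c hc].
by exists c; apply: hB.
Qed.

(** A basis of [C / B] followed by one of [B / A] is a basis of [C / A], and in it [f] is block
    triangular with diagonal blocks [M] and [N]. The block [K] records the component of [f (z i)] in
    [B / A]. *)
Lemma is_trace_add C B A (f : {linear V -> V}) s t : submodule A ->
  submodule B -> submodule C -> A `<=` B -> B `<=` C ->
  is_trace C B f s -> is_trace B A f t -> is_trace C A f (s + t).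
Proof.
move=> hA hB hC AB BC /is_traceE [n [z [M [hz hM ->]]]].
move=> /is_traceE [m [w [N [hw hN ->]]]].
pose e (i : 'I_(n + m)) := match fintype.split i with inl j => z j | inr j => w j end.
have eE c : lincomb c e = lincomb (lsubmx c) z + lincomb (rsubmx c) w.
  rewrite /lincomb big_split_ord /=; congr (_ + _); apply: eq_bigr => i _;
  rewrite /e mxE.
    by rewrite -[lshift m i]/(unsplit (inl i)) unsplitK.
  by rewrite -[rshift n i]/(unsplit (inr i)) unsplitK.
have Bw c : B (lincomb c w).
  by apply: submodule_sum => // i _; apply: submoduleZ => //; apply: hw.1.
have hK i : exists c : 'rV[F]_m, A (f (z i) - lincomb (row i M) z - lincomb c w).
  by have [c [hc _]] := hw.2 _ (hM i); exists c.
have [K {}hK] := choice hK.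
apply/is_traceE; exists (n + m)%N, e, (block_mx M (\matrix_i K i) 0 N); split.
- apply: quotient_freeP => //.
  + move=> c; rewrite eE => hc.
    have l0 : lsubmx c = 0.
      apply: (quotient_basis_free hC hB hz).
      by rewrite -[lincomb _ _](addrK (lincomb (rsubmx c) w)); apply: submoduleB (AB _ hc) _.
    move: hc; rewrite l0 lincomb0 add0r => /(quotient_basis_free hB hA hw) r0.
    by rewrite -[c]hsubmxK l0 r0 row_mx0.
  + by move=> i; rewrite /e; case: fintype.split => j; [apply: hz.1 | apply/BC/hw.1].
  + move=> v /hz.2 [c [hc _]]; have [d [hd _]] := hw.2 _ hc.
    by exists (row_mx c d); rewrite eE row_mxKl row_mxKr opprD addrA.
- move=> i; rewrite -(splitK i); case: (fintype.split i) => j; rewrite eE /e unsplitK /=.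
    rewrite /block_mx rowKu row_row_mx row_mxKl row_mxKr rowK opprD addrA.
    exact: hK.
  rewrite /block_mx rowKd row_row_mx row_mxKl row_mxKr row0 lincomb0 add0r.
  exact: hN.
- by rewrite mxtrace_block.
Qed.

End Subquotients.

(** The hypotheses say that [phi] induces an isomorphism from [Z / B] to [Z' / B'] intertwining [f]
    and [f'], so the image of a basis is a basis with the same matrix. *)
Lemma is_trace_transport (F : fieldType) (V W : lmodType F)
    (Z B : set V) (Z' B' : set W)
    (phi : {linear V -> W}) (f : V -> V) (f' : W -> W) t :
  submodule B -> submodule Z -> submodule B' ->
  (forall v, Z v -> Z (f v)) ->
  (forall v, Z v -> Z' (phi v)) -> (forall v, Z v -> B' (phi v) <-> B v) ->
  (forall v' : W, Z' v' -> exists2 v, Z v & B' (v' - phi v)) ->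
  (forall v, Z v -> B' (f' (phi v) - phi (f v))) ->
  is_trace Z B f t -> is_trace Z' B' f' t.
Proof.
move=> hB hZ hB' fZ ZZ BB onto comm /is_traceE [n [z [M [hz hM ->]]]].
apply/is_traceE; exists n, (fun i => phi (z i)), M; split=> //.
  have Zz c : Z (lincomb c z).
    by apply: submodule_sum => // i _; apply: submoduleZ => //; apply: hz.1.
  apply: quotient_freeP => // [c|i|v'].
  - by rewrite -lincomb_linear => /(BB _ (Zz c)).1; apply: (quotient_basis_free hZ hB hz).
  - exact/ZZ/hz.1.
  - move=> /onto [v Zv hv]; have [c [hc _]] := hz.2 _ Zv; exists c.
    apply: (submodule_trans hB' hv); rewrite -lincomb_linear -linearB.
    by apply/BB => //; apply: submoduleB.
move=> i; apply: (submodule_trans hB' (comm _ (hz.1 i))).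
rewrite -lincomb_linear -linearB; apply/BB => //.
apply: submoduleB => //; first exact/fZ/hz.1.
by apply: submodule_sum => // j _; apply: submoduleZ => //; apply: hz.1.
Qed.

(** * The standard complex *)

Section Semisums.
Context {S : addSemigroupType}.
Implicit Types (s t : seq S) (o : option S).

(** Adjoins [None] to the semigroup as a neutral element. Then [semisum] is an iterated operation of
    a commutative monoid, and the general results on such operations apply. *)
Definition oadd o1 o2 : option S :=
  if o1 is Some x then Some (oapp (+%R x) x o2) else o2.

Lemma oaddA : associative oadd.
Proof. by case=> [x|] [y|] [z|] //=; rewrite Algebra.addrA. Qed.

Lemma oaddC : commutative oadd.
Proof. by case=> [x|] [y|] //=; rewrite Algebra.addrC. Qed.

Lemma oadd0o : left_id None oadd. Proof. by []. Qed.

Lemma oaddo0 : right_id None oadd. Proof. by case. Qed.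

HB.instance Definition _ := Monoid.isComLaw.Build (option S) None oadd
  oaddA oaddC oadd0o.

Lemma semisum_cons x s : semisum (x :: s) = oadd (Some x) (semisum s).
Proof. by []. Qed.

Lemma semisumE s : semisum s = \big[oadd/None]_(x <- s) Some x.
Proof. by elim: s => [|x s IH]; rewrite ?big_nil // big_cons -IH. Qed.

Lemma semisum_cat s t : semisum (s ++ t) = oadd (semisum s) (semisum t).
Proof. by rewrite !semisumE big_cat. Qed.

Lemma semisum_perm s t : perm_eq s t -> semisum s = semisum t.
Proof. by move=> h; rewrite !semisumE; apply: perm_big. Qed.

End Semisums.

Section FreegLinear.
Context {F : fieldType} {K : choiceType} {M : lmodType F}.
Implicit Types (f : K -> M).

Lemma fglift_additive f : {morph fglift f : D E / D - E}.
Proof. exact: lift_is_additive. Qed.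

HB.instance Definition _ f := GRing.isZmodMorphism.Build {freeg K / F} M
  (fglift f) (@fglift_additive f).

Lemma fgliftE f (D : {freeg K / F}) :
  fglift f D = \sum_(x <- dom D) coeff x D *: f x.
Proof.
rewrite -{1}(freeg_sumE D) raddf_sum.
by apply: eq_bigr => x _; rewrite /= liftU.
Qed.

Lemma fglift_scalable f : scalable (fglift f).
Proof.
move=> c D.
have -> : c *: D = \sum_(x <- dom D) << c * coeff x D *g x >> by [].
rewrite (raddf_sum (fglift f)) (fgliftE f D) scaler_sumr.
by apply: eq_bigr => x _; rewrite /= liftU scalerA.
Qed.

HB.instance Definition _ f := GRing.isScalable.Build F {freeg K / F} M *:%R
  (fglift f) (@fglift_scalable f).

End FreegLinear.

(* Linear identities between words are checked coefficientwise. *)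
Ltac words_ring :=
  apply/eqP/freeg_eqP => ?; rewrite ?(coeffD, coeffN, coeffZ); ring.

Section Complex.
Context {F : fieldType} {Gamma : addSemigroupType} {A : zmodType}.
Variable theta : A -> A -> F.
Local Notation degree := (Gamma * A)%type.
Variables (L : lmodType F) (Lc : degree -> set L) (br : {bilinear L -> L -> L}).
Local Notation letter := (degree * L)%type.
Local Notation word := (seq letter).
Local Notation words := {freeg word / F}.
Local Notation th p q := (theta p.1.2 q.1.2).

Implicit Types (p q r : letter) (w : word) (Z : words).

Hypothesis theta_coloring : coloring theta.
Hypothesis Lie : color_lie_superalgebra theta Lc br.

Local Notation adj p := (fglift (adjoint theta br p)).

Definition homogeneous w := forall p, p \in w -> Lc p.1 p.2.

Definition hspan : set words := span [set c | exists2 w, homogeneous w & c = wd w].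

(** The relations of all lengths and degrees together, so that compatibility with the differential
    is checked without tracking gradings. [relationsP] recovers each graded piece. *)
Definition all_relations : set words :=
  span (
    [set r | exists w1 w2 y c u v,
       [/\ homogeneous (w1 ++ (y, u) :: w2), Lc y v
         & r = wd (w1 ++ (y, c *: u + v) :: w2)
               - c *: wd (w1 ++ (y, u) :: w2) - wd (w1 ++ (y, v) :: w2)]]
    `|`
    [set r | exists w1 w2 p q,
       homogeneous (w1 ++ p :: q :: w2) /\
       r = wd (w1 ++ p :: q :: w2) + th p q *: wd (w1 ++ q :: p :: w2)]).

Local Notation Rel := all_relations.

Lemma relS : submodule Rel. Proof. exact: span_submodule. Qed.
Lemma hspanS : submodule hspan. Proof. exact: span_submodule. Qed.

Lemma LcS x : submodule (Lc x).
Proof. by case: Lie => -[]. Qed.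

Lemma homogeneous_cons p w :
  homogeneous (p :: w) <-> Lc p.1 p.2 /\ homogeneous w.
Proof.
split=> [h|[hp hw] q].
  by split=> [|q qw]; apply: h; rewrite inE ?eqxx ?qw ?orbT.
by rewrite inE => /predU1P [->|/hw].
Qed.

Lemma homogeneous_cat w1 w2 :
  homogeneous (w1 ++ w2) <-> homogeneous w1 /\ homogeneous w2.
Proof.
split=> [h|[h1 h2] q]; first by split=> q qw; apply: h; rewrite mem_cat qw ?orbT.
by rewrite mem_cat => /orP [/h1|/h2].
Qed.

Lemma homogeneous_lbr p q : Lc p.1 p.2 -> Lc q.1 q.2 ->
  Lc (lbr br p q).1 (lbr br p q).2.
Proof. by move=> hp hq; apply: (color_lie_graded Lie). Qed.

Lemma wd_hspan w : homogeneous w -> hspan (wd w).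
Proof. by move=> hw; apply: sub_span; exists w. Qed.

Lemma rel_linear w1 w2 y c u v : homogeneous w1 -> homogeneous w2 ->
  Lc y u -> Lc y v ->
  Rel (wd (w1 ++ (y, c *: u + v) :: w2)
       - c *: wd (w1 ++ (y, u) :: w2) - wd (w1 ++ (y, v) :: w2)).
Proof.
move=> h1 h2 hu hv; apply: sub_span; left; exists w1, w2, y, c, u, v; split=> //.
by apply/homogeneous_cat; split=> //; apply/homogeneous_cons.
Qed.

Lemma rel_swap w1 w2 p q : homogeneous w1 -> homogeneous w2 ->
  Lc p.1 p.2 -> Lc q.1 q.2 ->
  Rel (wd (w1 ++ p :: q :: w2) + th p q *: wd (w1 ++ q :: p :: w2)).
Proof.
move=> h1 h2 hp hq; apply: sub_span; right; exists w1, w2, p, q; split=> //.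
apply/homogeneous_cat; split=> //.
by apply/homogeneous_cons; split=> //; apply/homogeneous_cons.
Qed.

(** Typically [S] is the preimage of [Rel] or of zero under a linear map, so that a map is checked
    to respect the relations on generators only. *)
Lemma rel_ind (S : set words) : submodule S ->
  (forall w1 w2 y c u v, homogeneous w1 -> homogeneous w2 -> Lc y u -> Lc y v ->
    S (wd (w1 ++ (y, c *: u + v) :: w2)
       - c *: wd (w1 ++ (y, u) :: w2) - wd (w1 ++ (y, v) :: w2))) ->
  (forall w1 w2 p q, homogeneous w1 -> homogeneous w2 ->
    Lc p.1 p.2 -> Lc q.1 q.2 ->
    S (wd (w1 ++ p :: q :: w2) + th p q *: wd (w1 ++ q :: p :: w2))) ->
  forall Z, Rel Z -> S Z.
Proof.
move=> hS h1 h2; apply: span_subP => // r [|].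
  move=> [w1 [w2 [y [c [u [v [/homogeneous_cat [hw1 /homogeneous_cons]]]]]]]].
  by move=> [hu hw2] hv ->; apply: h1.
move=> [w1 [w2 [p [q [/homogeneous_cat [hw1 /homogeneous_cons]]]]]].
by move=> [hp /homogeneous_cons [hq hw2]] ->; apply: h2.
Qed.

Lemma hspan_ind (S : set words) : submodule S ->
  (forall w, homogeneous w -> S (wd w)) -> forall Z, hspan Z -> S Z.
Proof. by move=> hS h; apply: span_subP => // c [w hw ->]; apply: h. Qed.

Lemma fglift_wd (M : lmodType F) (f : word -> M) w : fglift f (wd w) = f w.
Proof. by rewrite /wd liftU scale1r. Qed.

Lemma wedge_wd p w : wedge p (wd w) = wd (p :: w).
Proof. exact: fglift_wd. Qed.

HB.instance Definition _ p := GRing.Linear.on (wedge (F := F) p).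

Lemma words_ext (M : lmodType F) (f g : {linear words -> M}) :
  (forall w, f (wd w) = g (wd w)) -> f =1 g.
Proof.
move=> h Z; rewrite -[Z]freeg_sumE !linear_sum; apply: eq_bigr => w _ /=.
have -> : << coeff w Z *g w >> = coeff w Z *: wd w.
  by apply/eqP/freeg_eqP => y; rewrite coeffZ !coeffU mul1r.
by rewrite !linearZ /= h.
Qed.

Lemma wedge_hspan p Z : Lc p.1 p.2 -> hspan Z -> hspan (wedge p Z).
Proof.
move=> hp; apply: (hspan_ind (S := wedge p @^-1` hspan)).
  exact: submodule_preimage hspanS.
by move=> w hw; rewrite /preimage /= wedge_wd; apply: wd_hspan; apply/homogeneous_cons.
Qed.

Lemma wedge_rel p Z : Lc p.1 p.2 -> Rel Z -> Rel (wedge p Z).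
Proof.
move=> hp; apply: (rel_ind (S := wedge p @^-1` Rel)).
- exact: submodule_preimage relS.
- move=> w1 w2 y c u v h1 h2 hu hv; rewrite /preimage /= !linearB linearZ /= !wedge_wd.
  by apply: (rel_linear (w1 := p :: w1)) => //; apply/homogeneous_cons.
- move=> w1 w2 q r h1 h2 hq hr; rewrite /preimage /= linearD linearZ /= !wedge_wd.
  by apply: (rel_swap (w1 := p :: w1)) => //; apply/homogeneous_cons.
Qed.

Lemma wedge_linear y c u v Z : Lc y u -> Lc y v -> hspan Z ->
  Rel (wedge (y, c *: u + v) Z - c *: wedge (y, u) Z - wedge (y, v) Z).
Proof.
move=> hu hv.
apply: (hspan_ind (S := [set Z |
  Rel (wedge (y, c *: u + v) Z - c *: wedge (y, u) Z - wedge (y, v) Z)])).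
  split=> /= [|d Z1 Z2 h1 h2]; first by rewrite !linear0 !addr0; apply: submodule0 relS.
  move: (submoduleD relS (submoduleZ relS d h1) h2); congr (Rel _).
  rewrite !linearP; words_ring.
by move=> w hw /=; rewrite !wedge_wd; apply: (rel_linear (w1 := [::])).
Qed.

Lemma wedge_swap p q Z : Lc p.1 p.2 -> Lc q.1 q.2 -> hspan Z ->
  Rel (wedge p (wedge q Z) + th p q *: wedge q (wedge p Z)).
Proof.
move=> hp hq; apply: (hspan_ind (S := [set Z |
  Rel (wedge p (wedge q Z) + th p q *: wedge q (wedge p Z))])).
  split=> /= [|d Z1 Z2 h1 h2]; first by rewrite !linear0 !addr0; apply: submodule0 relS.
  move: (submoduleD relS (submoduleZ relS d h1) h2); congr (Rel _).
  rewrite !linearP; words_ring.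
by move=> w hw /=; rewrite !wedge_wd; apply: (rel_swap (w1 := [::])).
Qed.

Lemma adjoint_cons p q w : adjoint theta br p (q :: w) =
  wd (lbr br p q :: w) + th p q *: wedge q (adjoint theta br p w).
Proof. by []. Qed.

Lemma adj_wedge p q Z : adj p (wedge q Z) =
  wedge (lbr br p q) Z + th p q *: wedge q (adj p Z).
Proof.
pose f : {linear words -> words} := adj p \o wedge q.
pose g : {linear words -> words} :=
  (wedge (lbr br p q) \+ (th p q \*: (wedge q \o adj p)))%R.
rewrite -[LHS]/(f Z) -[RHS]/(g Z); apply: words_ext => w.
by rewrite /f /g /= !wedge_wd !fglift_wd.
Qed.

Lemma diff_wedge p Z : diff theta br (wedge p Z) = adj p Z - wedge p (diff theta br Z).
Proof.
pose f : {linear words -> words} := fglift (diff_word theta br) \o wedge p.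
pose g : {linear words -> words} :=
  (adj p \- (wedge p \o fglift (diff_word theta br)))%R.
rewrite -[LHS]/(f Z) -[RHS]/(g Z); apply: words_ext => w.
by rewrite /f /g /= !wedge_wd !fglift_wd.
Qed.

Local Notation ad := (adjoint theta br).
Local Notation d := (@diff F Gamma A theta L br).

HB.instance Definition _ := GRing.Linear.on (@diff F Gamma A theta L br).

Lemma adjoint_hspan p w : Lc p.1 p.2 -> homogeneous w -> hspan (ad p w).
Proof.
move=> hp; elim: w => [|q w IH]; first by move=> _; apply: submodule0 hspanS.
move=> /homogeneous_cons [hq hw]; rewrite adjoint_cons.
apply: (submoduleD hspanS).
  by apply: wd_hspan; apply/homogeneous_cons; split=> //; apply: homogeneous_lbr.
by apply: (submoduleZ hspanS); apply: wedge_hspan => //; apply: IH.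
Qed.

Lemma adjoint_linear y c u v w : Lc y u -> Lc y v -> homogeneous w ->
  Rel (ad (y, c *: u + v) w - c *: ad (y, u) w - ad (y, v) w).
Proof.
move=> hu hv; elim: w => [|q w IH].
  by move=> _; rewrite /= scaler0 !subr0; apply: submodule0 relS.
move=> /homogeneous_cons [hq hw]; rewrite !adjoint_cons /=.
have h1 : Rel (wd ((y + q.1, c *: br u q.2 + br v q.2) :: w)
    - c *: wd ((y + q.1, br u q.2) :: w) - wd ((y + q.1, br v q.2) :: w)).
  by apply: (rel_linear (w1 := [::])) => //; apply: (color_lie_graded Lie).
have h2 := submoduleZ relS (theta y.2 q.1.2) (wedge_rel hq (IH hw)).
move: (submoduleD relS h1 h2); rewrite {IH h1 h2} /lbr /= linearPl.
congr (Rel _); rewrite !linearB !linearZ /=; words_ring.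
Qed.

Lemma lbr_rel y c u v q w : Lc y u -> Lc y v -> Lc q.1 q.2 -> homogeneous w ->
  Rel (wd (lbr br q (y, c *: u + v) :: w) - c *: wd (lbr br q (y, u) :: w)
       - wd (lbr br q (y, v) :: w)).
Proof.
move=> hu hv hq hw; rewrite /lbr /= linearPr.
by apply: (rel_linear (w1 := [::])) => //; apply: (color_lie_graded Lie).
Qed.

(** The adjoint action descends to the quotient by the relations. A relation sits behind a prefix
    [w1]; induction on [w1] peels off its letters with the Leibniz rule. *)
Lemma adj_rel p Z : Lc p.1 p.2 -> Rel Z -> Rel (adj p Z).
Proof.
move=> hp; apply: (rel_ind (S := adj p @^-1` Rel)).
- exact: submodule_preimage relS.
- move=> w1 w2 y c u v h1 h2 hu hv; rewrite /preimage /= !linearB linearZ /= !fglift_wd.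
  elim: w1 h1 => [|q w1 IH] h1.
    have hZ : hspan (ad p w2) by apply: adjoint_hspan.
    have := submoduleD relS (lbr_rel c hu hv hp h2)
      (submoduleZ relS (theta p.1.2 y.2) (wedge_linear c hu hv hZ)).
    rewrite !cat0s !adjoint_cons; congr (Rel _); words_ring.
  have [hq {}h1] := (homogeneous_cons _ _).1 h1.
  have hl : homogeneous (lbr br p q :: w1).
    by apply/homogeneous_cons; split=> //; apply: homogeneous_lbr.
  have := submoduleD relS (rel_linear c hl h2 hu hv)
    (submoduleZ relS (th p q) (wedge_rel hq (IH h1))).
  rewrite !cat_cons !adjoint_cons !linearB !linearZ /=; congr (Rel _); words_ring.
- move=> w1 w2 q r h1 h2 hq hr; rewrite /preimage /= !linearD linearZ /= !fglift_wd.
  elim: w1 h1 => [|s w1 IH] h1.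
    have hZ : hspan (ad p w2) by apply: adjoint_hspan.
    have hpq := homogeneous_lbr hp hq; have hpr := homogeneous_lbr hp hr.
    have hnil : homogeneous [::] by [].
    (* The letter [p] acts on [q], on [r] or on [w2], giving one swap relation each. The color
       factors agree by [e1] and [e2], which expand [theta] at a sum of degrees. *)
    have R1 := rel_swap hnil h2 hpq hr.
    have R2 := submoduleZ relS (th p q) (rel_swap hnil h2 hq hpr).
    have R3 := submoduleZ relS (th p q * th p r) (wedge_swap hq hr hZ).
    move: (submoduleD relS (submoduleD relS R1 R2) R3).
    rewrite !cat0s !adjoint_cons !linearD !linearZ /= !wedge_wd.
    have e1 : theta (p.1 + q.1).2 r.1.2 = th p r * th q r.
      by rewrite (coloringDl theta_coloring).
    have e2 : th p q * theta q.1.2 (p.1 + r.1).2 = th q r.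
      by rewrite (coloringDr theta_coloring) mulrA (coloring_skew theta_coloring) mul1r.
    congr (Rel _); rewrite e1 -e2; words_ring.
  have [hs {}h1] := (homogeneous_cons _ _).1 h1.
  have hl : homogeneous (lbr br p s :: w1).
    by apply/homogeneous_cons; split=> //; apply: homogeneous_lbr.
  have := submoduleD relS (rel_swap hl h2 hq hr)
    (submoduleZ relS (th p s) (wedge_rel hs (IH h1))).
  rewrite !cat_cons !adjoint_cons !linearD !linearZ /=; congr (Rel _); words_ring.
Qed.

(** The adjoint action is a representation: the action of a bracket is the color commutator of the
    actions. On the head letter this is the Jacobi identity, on the tail the induction hypothesis;
    the mixed terms cancel. *)
Lemma adjoint_lbr p q w : Lc p.1 p.2 -> Lc q.1 q.2 -> homogeneous w ->
  Rel (ad (lbr br p q) w + th p q *: adj q (ad p w) - adj p (ad q w)).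
Proof.
move=> hp hq; elim: w => [|r w IH].
  by move=> _; rewrite /= !linear0 !addr0; apply: submodule0 relS.
move=> /homogeneous_cons [hr hw].
rewrite !adjoint_cons !linearD !linearZ /= !adj_wedge !fglift_wd.
rewrite !adjoint_cons /= !(coloringDl theta_coloring) !(coloringDr theta_coloring).
have hb (a b : letter) : Lc a.1 a.2 -> Lc b.1 b.2 -> Lc (a.1 + b.1) (br a.2 b.2).
  by move=> ha hb; apply: (color_lie_graded Lie).
(* The Jacobi identity holds between vectors, and multilinearity turns it into a relation between
   words. For this the three double brackets must be letters of literally the same degree, hence the
   reordering of sums. *)
have R1 : Rel (th p q *: wd (lbr br q (lbr br p r) :: w)
    + wd (lbr br (lbr br p q) r :: w) - wd (lbr br p (lbr br q r) :: w)).
  rewrite /lbr /= (color_lie_jacobi Lie _ hp hq) [_ + th p q *: _]addrC.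
  have -> : p.1 + (q.1 + r.1) = q.1 + (p.1 + r.1) by rewrite Algebra.addrCA.
  have -> : p.1 + q.1 + r.1 = q.1 + (p.1 + r.1) by rewrite Algebra.addrA [q.1 + _]Algebra.addrC.
  have h1 : Lc (q.1 + (p.1 + r.1)) (br q.2 (br p.2 r.2)).
    by apply: (hb (_, _) (_, br _ _)) => //; apply: hb.
  have h2 : Lc (q.1 + (p.1 + r.1)) (br (br p.2 q.2) r.2).
    rewrite Algebra.addrA [q.1 + _]Algebra.addrC.
    by apply: (hb (_, br _ _) (_, _)) => //; apply: hb.
  have := submoduleN relS (rel_linear (w1 := [::]) (th p q) _ hw h1 h2).
  by move=> /(_ (fun=> ltac:(done))); congr (Rel _); words_ring.
have R2 := submoduleZ relS (th p r * th q r) (wedge_rel hr (IH hw)).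
move: (submoduleD relS R1 R2); rewrite !linearB !linearD !linearZ /=.
have sc Z : (th q p * th q r) *: (th p q *: Z) = th q r *: Z.
  rewrite scalerA -[th q r in RHS]mul1r -(coloring_skew theta_coloring p.1.2 q.1.2).
  by congr (_ *: _); ring.
by rewrite sc; congr (Rel _); words_ring.
Qed.

Lemma diff_word_hspan w : homogeneous w -> hspan (diff_word theta br w).
Proof.
elim: w => [|p w IH]; first by move=> _; apply: submodule0 hspanS.
move=> /homogeneous_cons [hp hw] /=; apply: (submoduleB hspanS).
  exact: adjoint_hspan.
by apply: wedge_hspan => //; apply: IH.
Qed.

(** The differential is equivariant for the adjoint action. Expanding both sides on a word [q :: w],
    the terms not covered by induction are exactly those of [adjoint_lbr]. *)
Lemma diff_adj p w : Lc p.1 p.2 -> homogeneous w ->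
  Rel (d (ad p w) - adj p (d (wd w))).
Proof.
move=> hp; rewrite [d (wd w)]fglift_wd; elim: w => [|q w IH].
  by move=> _; rewrite /= !linear0 !addr0; apply: submodule0 relS.
move=> /homogeneous_cons [hq hw] /=.
have R1 := adjoint_lbr hp hq hw.
have R2 := submoduleZ relS (- th p q) (wedge_rel hq (IH hw)).
move: (submoduleD relS R1 R2).
rewrite !linearD !linearN !linearZ /= adj_wedge !diff_wedge [d (wd _)]fglift_wd /=.
by congr (Rel _); words_ring.
Qed.

(** Applying [d] to [d (p w) = p . w - p d w] gives [d (p . w) - p . d w + p d d w]: the difference
    vanishes by [diff_adj], the last term by induction. *)
Lemma diff_diff Z : hspan Z -> Rel (d (d Z)).
Proof.
apply: (hspan_ind (S := (d \o d) @^-1` Rel)) => [|w].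
  exact: (submodule_preimage [the {linear words -> words} of d \o d] relS).
rewrite /preimage /= [d (wd w)]fglift_wd; elim: w => [|p w IH].
  by move=> _; rewrite /= !linear0; apply: submodule0 relS.
move=> /homogeneous_cons [hp hw] /=.
have R1 := diff_adj hp hw.
have R2 := wedge_rel hp (IH hw).
move: (submoduleD relS R1 R2).
rewrite !linearB /= diff_wedge [d (wd _)]fglift_wd.
by congr (Rel _); words_ring.
Qed.

Lemma diff_rel Z : Rel Z -> Rel (d Z).
Proof.
apply: (rel_ind (S := d @^-1` Rel)).
- exact: submodule_preimage relS.
- move=> w1 w2 y c u v h1 h2 hu hv; rewrite /preimage /= !linearB linearZ /= ![d (wd _)]fglift_wd.
  elim: w1 h1 => [|q w1 IH] h1.
    have hZ := diff_word_hspan h2.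
    have := submoduleB relS (adjoint_linear c hu hv h2) (wedge_linear c hu hv hZ).
    by rewrite !cat0s /=; congr (Rel _); words_ring.
  have [hq {}h1] := (homogeneous_cons _ _).1 h1.
  have := submoduleB relS (adj_rel hq (rel_linear c h1 h2 hu hv)) (wedge_rel hq (IH h1)).
  rewrite !cat_cons /= !linearB !linearZ /= !fglift_wd; congr (Rel _); words_ring.
- move=> w1 w2 p q h1 h2 hp hq; rewrite /preimage /= !linearD linearZ /= ![d (wd _)]fglift_wd.
  elim: w1 h1 => [|s w1 IH] h1.
    have hZ := diff_word_hspan h2.
    have R1 := wedge_swap hp hq hZ.
    have hb : Lc (p.1 + q.1) (br q.2 p.2).
      by rewrite Algebra.addrC; apply: (color_lie_graded Lie).
    have hn : homogeneous [::] by [].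
    have R2 : Rel (wd ((p.1 + q.1, br p.2 q.2) :: w2) +
        th p q *: wd ((p.1 + q.1, br q.2 p.2) :: w2)).
      (* Skew symmetry of the bracket has to be read on words. [R3] is multilinearity with second
         vector 0, and [R4], with scalar -1 and both vectors 0, says that the word whose first
         letter carries the vector 0 is itself a relation. *)
      have L0 := submodule0 (LcS (p.1 + q.1)).
      have R3 := rel_linear (- th p q) hn h2 hb L0.
      have R4 := rel_linear (-1) hn h2 L0 L0.
      move: R3 R4; rewrite !cat0s (color_lie_skew Lie hp hq) addr0 scaler0 addr0 scaleNr.
      move=> R3 R4; have := submoduleD relS R3 R4.
      by congr (Rel _); words_ring.
    have := submoduleD relS R2 R1.
    rewrite !cat0s /= /lbr [q.1 + p.1]Algebra.addrC !linearB !linearD !linearZ /=.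
    have sc Z' : th q p *: (th p q *: Z') = Z'.
      by rewrite scalerA mulrC (coloring_skew theta_coloring) scale1r.
    rewrite sc.
    by congr (Rel _); words_ring.
  have [hs {}h1] := (homogeneous_cons _ _).1 h1.
  have := submoduleB relS (adj_rel hs (rel_swap h1 h2 hp hq)) (wedge_rel hs (IH h1)).
  rewrite !cat_cons /= !linearD !linearZ /= !fglift_wd; congr (Rel _); words_ring.
Qed.

End Complex.

(** * Grading of the complex, action of an automorphism, Euler-Poincare principle *)

Section GradedComplex.
Context {F : fieldType} {Gamma : addSemigroupType} {A : zmodType}.
Variable theta : A -> A -> F.
Local Notation degree := (Gamma * A)%type.
Variables (L : lmodType F) (Lc : degree -> set L) (br : {bilinear L -> L -> L}).
Local Notation letter := (degree * L)%type.
Local Notation word := (seq letter).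
Local Notation words := {freeg word / F}.
Local Notation th p q := (theta p.1.2 q.1.2).
Local Notation homogeneous := (homogeneous Lc).
Local Notation hspan := (hspan Lc).
Local Notation Rel := (all_relations theta Lc).
Local Notation d := (@diff F Gamma A theta L br).
Local Notation C := (chains Lc).
Local Notation R := (relations theta Lc).

Implicit Types (p q r : letter) (w : word) (Z : words) (o : option degree).

Hypothesis theta_coloring : coloring theta.
Hypothesis Lie : color_lie_superalgebra theta Lc br.

Definition word_degree w : option degree := semisum [seq p.1 | p <- w].

(** Degrees are taken in [option degree], because inductions on words pass through the empty word,
    whose degree is [None]. *)
Definition ochains k o : set words :=
  span [set c | exists2 w, [/\ size w = k, word_degree w = o & homogeneous w]
                & c = wd w].

Lemma chainsE k x : C k x = ochains k (Some x).
Proof. by []. Qed.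

Lemma ochainsS k o : submodule (ochains k o).
Proof. exact: span_submodule. Qed.

Lemma relationsS k x : submodule (R k x).
Proof. exact: span_submodule. Qed.

Lemma wd_ochains w : homogeneous w -> ochains (size w) (word_degree w) (wd w).
Proof. by move=> hw; apply: sub_span; exists w. Qed.

Lemma ochains_ind k o (S : set words) : submodule S ->
  (forall w, size w = k -> word_degree w = o -> homogeneous w -> S (wd w)) ->
  forall Z, ochains k o Z -> S Z.
Proof. by move=> hS h; apply: span_subP => // c [w [h1 h2 h3] ->]; apply: h. Qed.

Lemma ochains_hspan k o Z : ochains k o Z -> hspan Z.
Proof. by apply: ochains_ind => [|w _ _]; [apply: hspanS | apply: wd_hspan]. Qed.

Lemma wedge_ochains p k o Z : Lc p.1 p.2 -> ochains k o Z ->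
  ochains k.+1 (oadd (Some p.1) o) (wedge p Z).
Proof.
move=> hp.
apply: (ochains_ind (S := wedge p @^-1` ochains k.+1 (oadd (Some p.1) o))).
  exact: submodule_preimage (ochainsS _ _).
move=> w <- <- hw; rewrite /preimage /= wedge_wd.
by apply: (@wd_ochains (p :: w)); apply/homogeneous_cons.
Qed.

Lemma adjoint_ochains p w : Lc p.1 p.2 -> homogeneous w ->
  ochains (size w) (oadd (Some p.1) (word_degree w)) (adjoint theta br p w).
Proof.
move=> hp; elim: w => [|q w IH]; first by move=> _; apply: submodule0 (ochainsS _ _).
move=> /homogeneous_cons [hq hw]; rewrite adjoint_cons.
apply: (submoduleD (ochainsS _ _)).
  have -> : oadd (Some p.1) (word_degree (q :: w)) = word_degree (lbr br p q :: w).
    by rewrite /word_degree !map_cons !semisum_cons oaddA.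
  apply: (@wd_ochains (lbr br p q :: w)); apply/homogeneous_cons; split=> //.
  exact: (homogeneous_lbr Lie).
apply: (submoduleZ (ochainsS _ _)).
have -> : oadd (Some p.1) (word_degree (q :: w)) =
    oadd (Some q.1) (oadd (Some p.1) (word_degree w)).
  by rewrite /word_degree map_cons semisum_cons !oaddA [oadd (Some p.1) _]oaddC.
by apply: wedge_ochains => //; apply: IH.
Qed.

Lemma diff_ochains k o Z : ochains k.+1 o Z -> ochains k o (d Z).
Proof.
apply: (ochains_ind (S := d @^-1` ochains k o)).
  exact: submodule_preimage (ochainsS _ _).
move=> w; rewrite /preimage /= [d (wd w)]fglift_wd.
elim: w k o => [//|p w IH] k o [<-] <- /homogeneous_cons [hp hw] /=.
apply: (submoduleB (ochainsS _ _)); first exact: adjoint_ochains.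
(* The differential lowers the length by one only on nonempty words, so a single letter is treated
   apart. *)
case: w IH hw => [|q w] IH hw; first by rewrite linear0; apply: submodule0 (ochainsS _ _).
by apply: wedge_ochains => //; apply: IH.
Qed.

Definition proj_words k x : words -> words :=
  fglift (fun w => if (size w == k) && (word_degree w == Some x) then wd w else 0).

HB.instance Definition _ k x := GRing.Linear.on (proj_words k x).

Lemma proj_wd k x w : proj_words k x (wd w) =
  if (size w == k) && (word_degree w == Some x) then wd w else 0.
Proof. exact: fglift_wd. Qed.

Lemma proj_chains k x Z : C k x Z -> proj_words k x Z = Z.
Proof.
move=> h; apply/eqP; rewrite -subr_eq0; apply/eqP; move: h; rewrite chainsE.
pose f : {linear words -> words} := (proj_words k x \- idfun)%R.
apply: (ochains_ind (S := f @^-1` [set 0])).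
  exact: submodule_preimage (submodule_set0 _).
by move=> w h1 h2 hw; rewrite /preimage /= proj_wd h1 h2 !eqxx subrr.
Qed.

Lemma word_degree_perm w1 w2 : perm_eq w1 w2 -> word_degree w1 = word_degree w2.
Proof. by move=> h; apply/semisum_perm/perm_map. Qed.

Lemma proj_rel k x Z : Rel Z -> R k x (proj_words k x Z).
Proof.
apply: (rel_ind (S := proj_words k x @^-1` R k x)).
- exact: submodule_preimage (relationsS _ _).
- move=> w1 w2 y c u v h1 h2 hu hv; rewrite /preimage /= !linearB linearZ /= !proj_wd.
  rewrite /word_degree !size_cat !map_cat /=.
  case: andP => [[/eqP e1 /eqP e2]|_]; last first.
    by rewrite scaler0 !subr0; apply: submodule0 (relationsS _ _).
  apply: sub_span; left; exists w1, w2, y, c, u, v; split=> //; split.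
  + by rewrite size_cat.
  + by rewrite map_cat.
  + by apply/homogeneous_cat; split=> //; apply/homogeneous_cons.
- move=> w1 w2 p q h1 h2 hp hq; rewrite /preimage /= linearD linearZ /= !proj_wd.
  have hperm : perm_eq (w1 ++ q :: p :: w2) (w1 ++ p :: q :: w2).
    by rewrite perm_cat2l (perm_catCA [:: q] [:: p] w2).
  rewrite (perm_size hperm) (word_degree_perm hperm).
  case: andP => [[/eqP e1 /eqP e2]|_]; last first.
    by rewrite scaler0 addr0; apply: submodule0 (relationsS _ _).
  apply: sub_span; right; exists w1, w2, p, q; split=> //; split=> //.
  by apply/homogeneous_cat; split=> //; do 2![apply/homogeneous_cons; split=> //].
Qed.

Lemma relations_rel k x : R k x `<=` Rel.
Proof.
apply: span_subP; first exact: relS.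
move=> r [[w1 [w2 [y [c [u [v [[_ _ h] hv ->]]]]]]]|[w1 [w2 [p [q [[_ _ h] ->]]]]]].
  have [h1 /homogeneous_cons [hu h2]] := (homogeneous_cat _ _ _).1 h.
  exact: rel_linear.
have [h1 /homogeneous_cons [hp /homogeneous_cons [hq h2]]] :=
  (homogeneous_cat _ _ _).1 h.
exact: rel_swap.
Qed.

Lemma relations_chains k x : R k x `<=` C k x.
Proof.
apply: span_subP; first exact: ochainsS.
have hin w : size w = k -> word_degree w = Some x -> homogeneous w -> C k x (wd w).
  by move=> h1 h2 h3; rewrite chainsE -h1 -h2; apply: wd_ochains.
move=> r [[w1 [w2 [y [c [u [v [[hk hx h] hv ->]]]]]]]|[w1 [w2 [p [q [[hk hx h] ->]]]]]].
  have [h1 /homogeneous_cons [hu h2]] := (homogeneous_cat _ _ _).1 h.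
  have hw s : Lc y s -> C k x (wd (w1 ++ (y, s) :: w2)).
    move=> hs; apply: hin; first by rewrite -hk !size_cat.
      by rewrite -hx /word_degree !map_cat.
    by apply/homogeneous_cat; split=> //; apply/homogeneous_cons.
  apply: (submoduleB (ochainsS _ _)); last exact: hw.
  apply: (submoduleB (ochainsS _ _)); last by apply: (submoduleZ (ochainsS _ _)); apply: hw.
  by apply: hw; have [_] := LcS Lie y; apply.
have hperm : perm_eq (w1 ++ q :: p :: w2) (w1 ++ p :: q :: w2).
  by rewrite perm_cat2l (perm_catCA [:: q] [:: p] w2).
apply: (submoduleD (ochainsS _ _)); first exact: hin.
apply: (submoduleZ (ochainsS _ _)); apply: hin.
- by rewrite (perm_size hperm).
- by rewrite (word_degree_perm hperm).
- by move=> s; rewrite (perm_mem hperm); apply: h.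
Qed.

(** Every generating relation is homogeneous in length and degree, so [proj_words] sends [Rel] into
    [R k x]; and it fixes the elements of [C k x]. *)
Lemma relationsP k x Z : R k x Z <-> C k x Z /\ Rel Z.
Proof.
split=> [h|[h1 h2]]; last by have := proj_rel (k := k) (x := x) h2; rewrite proj_chains.
by split; [apply: relations_chains | apply: relations_rel h].
Qed.

Variable f : {linear L -> L}.
Hypothesis f_br : forall u v, f (br u v) = br (f u) (f v).
Hypothesis f_Lc : forall x u, Lc x u -> Lc x (f u).

Definition map_word w : word := [seq (p.1, f p.2) | p <- w].
Local Notation cm := (@chain_map F Gamma A L f).

HB.instance Definition _ := GRing.Linear.on (@chain_map F Gamma A L f).

Lemma chain_map_wd w : cm (wd w) = wd (map_word w).
Proof. exact: fglift_wd. Qed.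

Lemma map_word_homogeneous w : homogeneous w -> homogeneous (map_word w).
Proof. by move=> hw _ /mapP [p /hw hp ->]; apply: f_Lc. Qed.

Lemma word_degree_map w : word_degree (map_word w) = word_degree w.
Proof. by rewrite /word_degree -map_comp. Qed.

Lemma chain_map_chains k x Z : C k x Z -> C k x (cm Z).
Proof.
rewrite chainsE; apply: (ochains_ind (S := cm @^-1` ochains k (Some x))).
  exact: submodule_preimage (ochainsS _ _).
move=> w <- <- hw; rewrite /preimage /= chain_map_wd -word_degree_map.
have := wd_ochains (map_word_homogeneous hw); by rewrite size_map.
Qed.

Lemma chain_map_rel Z : Rel Z -> Rel (cm Z).
Proof.
apply: (rel_ind (S := cm @^-1` Rel)).
- exact: submodule_preimage (relS _ _).
- move=> w1 w2 y c u v h1 h2 hu hv; rewrite /preimage /= !linearB linearZ /= !chain_map_wd.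
  rewrite /map_word !map_cat /= linearP.
  apply: rel_linear.
  - exact: map_word_homogeneous.
  - exact: map_word_homogeneous.
  - exact: f_Lc.
  - exact: f_Lc.
- move=> w1 w2 p q h1 h2 hp hq; rewrite /preimage /= linearD linearZ /= !chain_map_wd.
  rewrite /map_word !map_cat /=.
  apply: (rel_swap (w1 := map_word w1) (w2 := map_word w2)
    (p := (p.1, f p.2)) (q := (q.1, f q.2))).
  - exact: map_word_homogeneous.
  - exact: map_word_homogeneous.
  - exact: f_Lc.
  - exact: f_Lc.
Qed.

Lemma chain_map_relations k x Z : R k x Z -> R k x (cm Z).
Proof.
move=> /relationsP [h1 h2]; apply/relationsP; split.
  exact: chain_map_chains.
exact: chain_map_rel.
Qed.

Lemma chain_map_wedge p Z : cm (wedge p Z) = wedge (p.1, f p.2) (cm Z).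
Proof.
rewrite -[LHS]/((cm \o wedge p) Z) -[RHS]/((wedge (p.1, f p.2) \o cm) Z).
apply: (words_ext (f := [the {linear words -> words} of _ \o _])
                  (g := [the {linear words -> words} of _ \o _])) => w.
by rewrite /= !wedge_wd !chain_map_wd wedge_wd.
Qed.

Lemma chain_map_adjoint p w :
  cm (adjoint theta br p w) = adjoint theta br (p.1, f p.2) (map_word w).
Proof.
elim: w => [|q w IH]; first by rewrite /= linear0.
by rewrite /= linearD linearZ /= chain_map_wedge chain_map_wd IH /lbr /= f_br.
Qed.

Lemma chain_map_diff Z : cm (d Z) = d (cm Z).
Proof.
rewrite -[LHS]/((cm \o d) Z) -[RHS]/((d \o cm) Z).
apply: (words_ext (f := [the {linear words -> words} of _ \o _])
                  (g := [the {linear words -> words} of _ \o _])) => w.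
rewrite /= chain_map_wd [d _]fglift_wd [d _]fglift_wd.
elim: w => [|p w IH]; first by rewrite /= linear0.
by rewrite /= linearB /= chain_map_wedge chain_map_adjoint IH.
Qed.

Local Notation Zc := (cycles theta Lc br).
Local Notation Bc := (boundaries theta Lc br).

Lemma cyclesS k x : submodule (Zc k x).
Proof.
have -> : Zc k x = C k x `&` (d @^-1` R k.-1 x) by [].
apply: submoduleI; first exact: ochainsS.
exact: submodule_preimage (relationsS _ _).
Qed.

Lemma boundariesS k x : submodule (Bc k x).
Proof.
split=> [|c u v [z1 h1 r1] [z2 h2 r2]].
  exists 0; first exact: submodule0 (ochainsS _ _).
  by rewrite linear0 subr0; apply: submodule0 (relationsS _ _).
exists (c *: z1 + z2); first by case: (ochainsS k.+1 (Some x)) => _; apply.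
have := submoduleD (relationsS _ _) (submoduleZ (relationsS _ _) c r1) r2.
by congr (R _ _ _); rewrite linearP; words_ring.
Qed.

Lemma diff_chains k x Z : C k.+1 x Z -> C k x (d Z).
Proof. exact: diff_ochains. Qed.

Lemma relations_boundaries k x : R k x `<=` Bc k x.
Proof.
move=> Z hZ; exists 0; first exact: submodule0 (ochainsS _ _).
by rewrite linear0 subr0.
Qed.

Lemma boundaries_cycles k x : Bc k.+1 x `<=` Zc k.+1 x.
Proof.
move=> b [c hc hr]; have hdc := diff_chains hc; split.
  rewrite -(subrK (d c) b); apply: (submoduleD (ochainsS k.+1 (Some x))) => //.
  exact: relations_chains.
apply/relationsP; rewrite -{1 2}(subrK (d c) b) linearD; split.
  apply: (submoduleD (ochainsS _ _)); last by do 2!apply: diff_chains.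
  by apply: diff_chains; apply: relations_chains.
apply: (submoduleD (relS _ _)).
  by apply: (diff_rel theta_coloring Lie); apply: relations_rel hr.
by apply: (diff_diff theta_coloring Lie); apply: ochains_hspan hc.
Qed.

Lemma cycles_chains k x : Zc k x `<=` C k x.
Proof. by move=> c []. Qed.

Lemma chain_map_cycles k x Z : Zc k x Z -> Zc k x (cm Z).
Proof.
move=> [h1 h2]; split; first exact: chain_map_chains.
by rewrite -chain_map_diff; apply: chain_map_relations.
Qed.

Lemma chain_map_boundaries k x Z : Bc k x Z -> Bc k x (cm Z).
Proof.
move=> [c h1 h2]; exists (cm c); first exact: chain_map_chains.
by rewrite -chain_map_diff -linearB; apply: chain_map_relations.
Qed.

(** A single letter has nothing to be bracketed with, so the complex starts with a zero
    differential. This closes the telescoping sum at its lower end. *)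
Lemma cycles1 x : C 1%N x `<=` Zc 1%N x.
Proof.
move=> Z h; split=> //; suff -> : d Z = 0 by apply: submodule0 (relationsS _ _).
move: h; rewrite chainsE; apply: (ochains_ind (S := d @^-1` [set 0])).
  exact: submodule_preimage (submodule_set0 _).
move=> [|p [|q w]] // _ _ _; rewrite /preimage /= [d (wd _)]fglift_wd /=.
by rewrite linear0 subr0.
Qed.

(* Telescoping: d identifies chains (k + 1) / cycles (k + 1) with
   boundaries k / relations k, so that these traces cancel. *)
Lemma str_homology_chains x n (t : nat -> F) :
  (forall w, word_degree w = Some x -> (size w <= n)%N) ->
  (forall k, is_trace (C k x) (R k x) cm (t k)) ->
  str_homology theta Lc br f x =
    psi theta x.2 * \sum_(1 <= k < n.+1) (-1) ^+ k.+1 * t k.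
Proof.
move=> hn ht.
have C0 k Z : (n < k)%N -> C k x Z -> R k x Z.
  move=> nk; rewrite chainsE; apply: ochains_ind; first exact: relationsS.
  by move=> w hk /hn; rewrite hk leqNgt nk.
have fin k : quotient_fin (C k x) (R k x).
  have [m [z [_ [[_ hz] _ _]]]] := (is_traceE _ _ _ _).1 (ht k).
  by exists m, z => v /hz [c [hc _]]; exists c.
have RC := @relations_chains; have RB := @relations_boundaries.
have BZ := @boundaries_cycles; have ZC := @cycles_chains.
pose z k := trace (C k x) (Zc k x) cm.
pose h k := trace (Zc k x) (Bc k x) cm.
pose b k := trace (Bc k x) (R k x) cm.
have zP k : is_trace (C k.+1 x) (Zc k.+1 x) cm (z k.+1).
  apply: traceP; [exact: ochainsS|exact: cyclesS|by move=> v; apply: chain_map_chains|].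
  by apply: quotient_fin_sub (fin k.+1) => // v /RB /BZ.
have hP k : is_trace (Zc k.+1 x) (Bc k.+1 x) cm (h k.+1).
  apply: traceP; [exact: cyclesS|exact: boundariesS|by move=> v; apply: chain_map_cycles|].
  by apply: (quotient_fin_sub _ _ (fin k.+1)); [apply: ZC | apply: RB].
have bP k : is_trace (Bc k.+1 x) (R k.+1 x) cm (b k.+1).
  apply: traceP; [exact: boundariesS|exact: relationsS|by move=> v; apply: chain_map_boundaries|].
  by apply: quotient_fin_sub (fin k.+1) => // v /BZ /ZC.
(* Additivity along the filtration of chains by cycles, boundaries and relations. *)
have tE k : t k.+1 = z k.+1 + (h k.+1 + b k.+1).
  apply: (is_trace_uniq (ochainsS _ _) (relationsS _ _) _ (ht k.+1)).
    by move=> v; apply: chain_map_relations.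
  have ZR : is_trace (Zc k.+1 x) (R k.+1 x) cm (h k.+1 + b k.+1).
    by apply: is_trace_add (hP k) (bP k);
      [exact: relationsS|exact: boundariesS|exact: cyclesS|exact: RB|exact: BZ].
  by apply: is_trace_add (zP k) ZR;
    [exact: relationsS|exact: cyclesS|exact: ochainsS|move=> v /RB /BZ|exact: ZC].
have zb k : z k.+2 = b k.+1.
  apply: (is_trace_uniq (f := cm) (boundariesS k.+1 x) (relationsS k.+1 x) _ _ (bP k)).
    by move=> v; apply: chain_map_relations.
  apply: (is_trace_transport (phi := d) _ _ _ _ _ _ _ _ (zP k.+1)).
  - exact: cyclesS.
  - exact: ochainsS.
  - exact: relationsS.
  - by move=> v; apply: chain_map_chains.
  - move=> v hv; exists v => //; rewrite subrr; exact: submodule0 (relationsS _ _).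
  - by move=> v hv; split=> [hr|[]].
  - by move=> v' [v hv hr]; exists v.
  - by move=> v hv; rewrite /= chain_map_diff subrr; apply: submodule0 (relationsS _ _).
have tr0 (Z B : set words) : submodule Z -> submodule B -> Z `<=` B ->
    (forall v, B v -> B (cm v)) -> trace Z B cm = 0.
  move=> hZ hB ZB fB; apply: is_trace_trace => //; apply/is_traceE.
  exists 0%N, (fun=> 0), 0; split; [|by case|by rewrite mxtrace0].
  split=> [[]//|v /ZB hv]; exists 0; split; first by rewrite lincomb0 subr0.
  by move=> c _; apply/rowP => -[].
have z1 : z 1%N = 0.
  apply: tr0; [exact: ochainsS|exact: cyclesS|exact: cycles1|].
  by move=> v; apply: chain_map_cycles.
have zn : z n.+1 = 0.
  apply: tr0; [exact: ochainsS|exact: cyclesS| |by move=> v; apply: chain_map_cycles].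
  by move=> v /C0 -/(_ (ltnSn n)) /RB /BZ.
have h0 k : (n < k)%N -> h k = 0.
  case: k => // k nk; apply: tr0; [exact: cyclesS|exact: boundariesS| |].
    by move=> v [/C0 -/(_ nk) /RB].
  by move=> v; apply: chain_map_boundaries.
have -> : str_homology theta Lc br f x =
    psi theta x.2 * \sum_(1 <= k < n.+1) (-1) ^+ k.+1 * h k.
  rewrite /str_homology mulr_sumr [RHS]fsbig_seq ?iota_uniq //.
  transitivity (\sum_(k \in [set k | (1 <= k)%N]) psi theta x.2 * ((-1) ^+ k.+1 * h k)).
    by apply: eq_fsbigr => k _; rewrite /str_homology_k /str mulrCA.
  apply/esym; apply: fsbig_widen => [k|k [/= k1]]; rewrite /= mem_index_iota.
    by case/andP.
  by rewrite k1 ltnS => /negP; rewrite -ltnNge => /h0 ->; rewrite !mulr0.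
congr (_ * _); apply/eqP; rewrite eq_sym -subr_eq0 -sumrB.
(* Each summand is a signed [z k + b k] with [b k = z k.+1], so only the two ends remain; they
   vanish by [z1] and, for [m = n], by [zn]. *)
have step m : \sum_(1 <= k < m.+1) ((-1) ^+ k.+1 * t k - (-1) ^+ k.+1 * h k) =
    (-1) ^+ m.+1 * z m.+1.
  elim: m => [|m IH]; first by rewrite big_geq // z1 mulr0.
  rewrite big_nat_recr //= IH tE zb [(-1) ^+ m.+2]exprS; ring.
by rewrite step zn mulr0.
Qed.

End GradedComplex.

(** * Traces on chains *)

Section Monomials.
Context {F : fieldType} {Gamma : addSemigroupType} {A : zmodType}.
Variable theta : A -> A -> F.
Local Notation degree := (Gamma * A)%type.
Variables (L : lmodType F) (Lc : degree -> set L) (br : {bilinear L -> L -> L}).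
Local Notation letter := (degree * L)%type.
Local Notation word := (seq letter).
Local Notation words := {freeg word / F}.
Local Notation homogeneous := (homogeneous Lc).
Local Notation Rel := (all_relations theta Lc).

Hypothesis F2 : (2 : F) != 0.
Hypothesis theta_coloring : coloring theta.
Hypothesis Lie : color_lie_superalgebra theta Lc br.

Variables (I : finType) (deg : I -> degree) (vec : I -> L) (coord : I -> L -> F).
Local Notation th i j := (theta (deg i).2 (deg j).2).

Hypothesis vec_deg : forall i, Lc (deg i) (vec i).
Hypothesis coord_vec : forall i j, deg i = deg j -> coord i (vec j) = (i == j)%:R.
Hypothesis coord_linear : forall i c u v, Lc (deg i) u -> Lc (deg i) v ->
  coord i (c *: u + v) = c * coord i u + coord i v.

Definition basis_word (s : seq I) : word := [seq (deg i, vec i) | i <- s].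
Local Notation bw := basis_word.

Lemma basis_word_homogeneous s : homogeneous (bw s).
Proof. by move=> _ /mapP [i _ ->]; apply: vec_deg. Qed.

Section Expansion.
Context {M : lmodType F}.
Implicit Types (phi : seq I -> M).

(* Extends phi, given on words of basis letters, multilinearly. *)
Fixpoint expand (w : word) phi : M :=
  if w is p :: w' then
    \sum_(i | deg i == p.1) coord i p.2 *: expand w' (fun s => phi (i :: s))
  else phi [::].

Lemma eq_expand w phi phi' : phi =1 phi' -> expand w phi = expand w phi'.
Proof.
elim: w phi phi' => [|p w IH] phi phi' h /=; first exact: h.
by apply: eq_bigr => i _; congr (_ *: _); apply: IH.
Qed.

Lemma expand_rel (B : set M) w phi phi' : submodule B ->
  (forall s, B (phi s - phi' s)) -> B (expand w phi - expand w phi').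
Proof.
move=> hB; elim: w phi phi' => [|p w IH] phi phi' h /=; first exact: h.
rewrite -sumrB; apply: submodule_sum => // i _.
by rewrite -scalerBr; apply: submoduleZ => //; apply: IH.
Qed.

Lemma expand_in (B : set M) w phi : submodule B ->
  (forall s, [seq deg i | i <- s] = [seq p.1 | p <- w] -> B (phi s)) ->
  B (expand w phi).
Proof.
move=> hB; elim: w phi => [|p w IH] phi h /=; first exact: h.
apply: submodule_sum => // i /eqP ip; apply: submoduleZ => //; apply: IH => s hs.
by apply: h; rewrite /= ip hs.
Qed.

Lemma expand_sum w (J : finType) (P : pred J) (c : J -> F) (phi : J -> seq I -> M) :
  expand w (fun s => \sum_(j | P j) c j *: phi j s) =
  \sum_(j | P j) c j *: expand w (phi j).
Proof.
elim: w phi => [//|p w IH] phi /=.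
under eq_bigr do rewrite IH scaler_sumr.
rewrite exchange_big /=; apply: eq_bigr => j _.
by rewrite scaler_sumr; apply: eq_bigr => i _; rewrite !scalerA mulrC.
Qed.

Lemma expand_linear w1 w2 y c u v phi : Lc y u -> Lc y v ->
  expand (w1 ++ (y, c *: u + v) :: w2) phi =
  c *: expand (w1 ++ (y, u) :: w2) phi + expand (w1 ++ (y, v) :: w2) phi.
Proof.
move=> hu hv; elim: w1 phi => [|p w1 IH] phi /=; rewrite scaler_sumr -big_split /=.
  apply: eq_bigr => i /eqP yi.
  by rewrite coord_linear ?yi // scalerDl !scalerA.
by apply: eq_bigr => i _; rewrite IH scalerDr !scalerA mulrC.
Qed.

Definition alternating phi := forall s1 s2 i j,
  phi (s1 ++ i :: j :: s2) + th i j *: phi (s1 ++ j :: i :: s2) = 0.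

Lemma expandD w phi phi' c :
  expand w (fun s => phi s + c *: phi' s) = expand w phi + c *: expand w phi'.
Proof.
elim: w phi phi' => [//|p w IH] phi phi' /=.
rewrite scaler_sumr -big_split; apply: eq_bigr => i _ /=.
by rewrite IH scalerDr !scalerA mulrC.
Qed.

Lemma expand0 w : expand w (fun=> 0) = 0.
Proof.
by elim: w => [//|p w IH] /=; apply: big1 => i _; rewrite IH scaler0.
Qed.

Lemma expand_swap w1 w2 (p q : letter) phi : alternating phi ->
  expand (w1 ++ p :: q :: w2) phi
  + theta p.1.2 q.1.2 *: expand (w1 ++ q :: p :: w2) phi = 0.
Proof.
elim: w1 phi => [|r w1 IH] phi halt /=; last first.
  rewrite scaler_sumr -big_split /= big1 // => i _.
  rewrite scalerA mulrC -scalerA -scalerDr IH ?scaler0 // => s1 s2 j k.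
  exact: (halt (i :: s1)).
under eq_bigr do rewrite scaler_sumr.
under [X in _ *: X]eq_bigr do rewrite scaler_sumr.
rewrite [X in _ *: X]exchange_big /= scaler_sumr -big_split big1 // => i /eqP ip /=.
rewrite scaler_sumr -big_split big1 // => j /eqP jq /=.
have -> (a b c : F) (u v : M) : a *: (b *: u) + c *: (b *: (a *: v)) =
    (a * b) *: (u + c *: v).
  by rewrite scalerDr !scalerA; congr (_ + _ *: _); ring.
rewrite -ip -jq -expandD (@eq_expand w2 _ (fun=> 0)) ?expand0 ?scaler0 //.
by move=> s; apply: (halt [::]).
Qed.

Lemma expand_basis s phi : expand (bw s) phi = phi s.
Proof.
elim: s phi => [//|j s IH] phi /=; rewrite (bigD1 j) //= big1 => [|i /andP [/eqP ij ne]].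
  by rewrite coord_vec // eqxx scale1r addr0 IH.
by rewrite coord_vec // (negbTE ne) scale0r.
Qed.

Definition functional phi : words -> M := fglift (fun w => expand w phi).

HB.instance Definition _ phi := GRing.Linear.on (functional phi).

Lemma functional_wd phi w : functional phi (wd w) = expand w phi.
Proof. exact: fglift_wd. Qed.

(** A function on basis words that respects swaps descends to the quotient by the relations. This is
    the source of functionals separating the monomials. *)
Lemma functional_rel phi Z : alternating phi -> Rel Z -> functional phi Z = 0.
Proof.
move=> halt; apply: (rel_ind (S := functional phi @^-1` [set 0])).
- exact: submodule_preimage (submodule_set0 _).
- move=> w1 w2 y c u v h1 h2 hu hv; rewrite /preimage /= !linearB linearZ /=.
  rewrite !functional_wd expand_linear //.
  by rewrite -addrA -opprD subrr.
- move=> w1 w2 p q _ _ _ _; rewrite /preimage /= linearD linearZ /=.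
  by rewrite !functional_wd expand_swap.
Qed.

End Expansion.

Section Degree.
Variable D : degree -> Prop.
Hypothesis coord_span : forall y u, D y -> Lc y u ->
  u = \sum_(i | deg i == y) coord i u *: vec i.

Lemma wd_sum (J : finType) (P : pred J) y (c : J -> F) (v : J -> L) w :
  (forall j, P j -> Lc y (v j)) -> homogeneous w ->
  Rel (wd ((y, \sum_(j | P j) c j *: v j) :: w)
       - \sum_(j | P j) c j *: wd ((y, v j) :: w)).
Proof.
move=> hv hw; elim: (index_enum J) => [|j s IH].
  rewrite !big_nil subr0.
  (* The empty sum requires that a word starting with a zero vector be a relation: multilinearity
     with scalar -1 and both vectors 0. *)
  have L0 := submodule0 (LcS Lie y); have hn : homogeneous [::] by [].
  have := rel_linear (theta := theta) (-1) hn hw L0 L0.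
  rewrite scaler0 addr0; congr (Rel _); rewrite scaleN1r opprK.
  by rewrite /= addrK.
rewrite !big_cons; case: ifP => // Pj.
have hn : homogeneous [::] by [].
have hs : Lc y (\sum_(j <- s | P j) c j *: v j).
  apply: (submodule_sum (LcS Lie y)) => k Pk.
  by apply: (submoduleZ (LcS Lie y)); apply: hv.
have := submoduleD (relS _ _) (rel_linear (theta := theta) (c j) hn hw (hv _ Pj) hs) IH.
rewrite /=; congr (Rel _).
by rewrite addrA subrK opprD addrA.
Qed.

(** Basis words span modulo the relations. [D] confines this to the degrees where the chosen vectors
    do span. *)
Lemma wd_expand w : homogeneous w -> (forall p, p \in w -> D p.1) ->
  Rel (wd w - expand w (fun s => wd (bw s))).
Proof.
elim: w => [|p w IH]; first by move=> _ _; rewrite subrr; apply: submodule0 (relS _ _).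
move=> /homogeneous_cons [hp hw] hD /=.
have Dp : D p.1 by apply: hD; rewrite mem_head.
have {}IH := IH hw (fun q h => hD q (mem_behead (s := p :: w) h)).
have := wedge_rel hp IH; rewrite linearB /= wedge_wd => h1.
apply: (submodule_trans (relS _ _) h1).
have -> phi : wedge p (expand w phi) = expand w (fun s => wedge p (phi s)).
  elim: w phi {hw hD IH h1} => [//|q w IH] phi /=.
  by rewrite linear_sum; apply: eq_bigr => i _; rewrite linearZ /= IH.
rewrite -(expand_sum w _ _ (fun i s => wd (bw (i :: s)))).
apply: expand_rel => [|s]; first exact: relS.
rewrite wedge_wd.
have e : p = (p.1, \sum_(i | deg i == p.1) coord i p.2 *: vec i).
  by rewrite -coord_span //; case: (p).
have := @wd_sum I (fun i => deg i == p.1) p.1 (fun i => coord i p.2) vec (bw s) _ _.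
rewrite -e => h; have {}h := h _ (@basis_word_homogeneous s).
apply: (submodule_trans (relS _ _) (h _)); first by move=> i /eqP <-; apply: vec_deg.
under eq_bigr => i /eqP <- do [].
exact: submodule_refl (relS _ _) _.
Qed.

End Degree.

Definition even i := psi theta (deg i).2 == 1.

Lemma psi_even i : psi theta (deg i).2 = if even i then 1 else -1.
Proof.
rewrite /even; case: eqP => // /eqP h; apply/eqP; rewrite -subr_eq0 opprK.
have := coloring_skew theta_coloring (deg i).2 (deg i).2.
move=> /eqP; rewrite -subr_eq0 -[X in _ - X](expr1n _ 2) -expr2 subr_sqr mulf_eq0 subr_eq0.
by rewrite -[theta _ _]/(psi theta _) (negbTE h).
Qed.

Lemma th_neq0 i j : th i j != 0.
Proof.
apply/eqP => h; have := coloring_skew theta_coloring (deg i).2 (deg j).2.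
by rewrite h mul0r => /eqP; rewrite eq_sym oner_eq0.
Qed.

(** The contribution of a letter [i] standing before [j] to the factor that sorts a word. It is
    arranged so that exchanging the two multiplies it by [- th i j]; for a repeated even letter this
    forces the value 0. *)
Definition pair_sign i j : F :=
  if i == j then (if even i then 0 else 1)
  else if (enum_rank j < enum_rank i)%N then - th i j else 1.

Fixpoint word_sign (s : seq I) : F :=
  if s is i :: s' then (\prod_(j <- s') pair_sign i j) * word_sign s' else 1.

Lemma pair_sign_swap i j : pair_sign i j = - th i j * pair_sign j i.
Proof.
rewrite /pair_sign [j == i]eq_sym; case: (eqVneq i j) => [->|ne].
  rewrite -[theta _ _]/(psi theta _) psi_even; case: ifP => _; first by rewrite mulr0.
  by rewrite opprK mulr1.
have := coloring_skew theta_coloring (deg i).2 (deg j).2 => hs.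
case: ltngtP => [_|_|/ord_inj/enum_rank_inj e]; rewrite ?mulr1 //.
  by rewrite mulrNN hs.
by rewrite e eqxx in ne.
Qed.

Lemma word_sign_swap s1 s2 i j :
  word_sign (s1 ++ i :: j :: s2) = - th i j * word_sign (s1 ++ j :: i :: s2).
Proof.
elim: s1 => [|k s1 IH] /=.
  rewrite !big_cons pair_sign_swap; ring.
rewrite IH !big_cat /= !big_cons; ring.
Qed.

Lemma word_sign_neq0 s : (forall i, even i -> (count_mem i s <= 1)%N) ->
  word_sign s != 0.
Proof.
elim: s => [|i s IH] h /=; first exact: oner_neq0.
rewrite mulf_neq0 ?IH //; last first.
  by move=> j /h /=; apply: leq_trans; rewrite leq_addl.
rewrite prodf_seq_neq0; apply/allP => j js /=; rewrite /pair_sign.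
case: (eqVneq i j) => [ij|_]; last first.
  by case: ifP => _; rewrite ?oppr_eq0 ?th_neq0 ?oner_neq0.
case: ifP => [/h|_]; last exact: oner_neq0.
by rewrite /= eqxx add1n ltnS leqn0 ij => /eqP /count_memPn; rewrite js.
Qed.

(** If [t] repeats no even letter, this is the coordinate along the monomial [t], up to the nonzero
    factor [word_sign t]. *)
Definition sign_functional (t s : seq I) : F^o := word_sign s * (perm_eq s t)%:R.

Lemma sign_functional_alternating t : alternating (sign_functional t).
Proof.
move=> s1 s2 i j; rewrite /sign_functional.
have -> : perm_eq (s1 ++ i :: j :: s2) t = perm_eq (s1 ++ j :: i :: s2) t.
  apply: permPl; first by rewrite perm_cat2l (perm_catCA [:: i] [:: j] s2).
by rewrite word_sign_swap /GRing.scale /=; ring.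
Qed.

(** The scalar is left unspecified: spanning needs only its existence, and exact signs are the
    business of [sign_functional]. *)
Lemma perm_basis_word s t : perm_eq s t ->
  exists c : F, Rel (wd (bw s) - c *: wd (bw t)).
Proof.
have front s1 i s2 : exists c : F,
    Rel (wd (bw (i :: s1 ++ s2)) - c *: wd (bw (s1 ++ i :: s2))).
  elim: s1 => [|j s1 [c IH]].
    by exists 1; rewrite scale1r subrr; apply: submodule0 (relS _ _).
  have := wedge_rel (vec_deg j : Lc (deg j, vec j).1 (deg j, vec j).2) IH.
  rewrite linearB linearZ /= !wedge_wd => h1.
  have hn : homogeneous [::] by [].
  have h2 := rel_swap (theta := theta) hn (@basis_word_homogeneous (s1 ++ s2))
    (p := (deg i, vec i)) (q := (deg j, vec j)) (vec_deg i) (vec_deg j).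
  exists (- th i j * c).
  have := submoduleD (relS _ _) h2 (submoduleZ (relS _ _) (- th i j) h1).
  by congr (Rel _); rewrite /=; words_ring.
elim: s t => [|i s IH] t.
  rewrite perm_sym => /perm_nilP ->; exists 1; rewrite scale1r subrr; exact: submodule0 (relS _ _).
move=> hst; have it : i \in t by rewrite -(perm_mem hst) mem_head.
case: (path.splitPr it) hst => t1 t2 hst.
have {}hst : perm_eq s (t1 ++ t2).
  by move: hst; rewrite perm_sym (perm_catCA t1 [:: i] t2) /= perm_cons perm_sym.
have [c hc] := IH _ hst; have [c' hc'] := front t1 i t2.
have := wedge_rel (vec_deg i : Lc (deg i, vec i).1 (deg i, vec i).2) hc.
rewrite linearB linearZ /= !wedge_wd => h1; exists (c * c').
have := submoduleD (relS _ _) h1 (submoduleZ (relS _ _) c hc').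
by congr (Rel _); rewrite /=; words_ring.
Qed.

(** With the two copies adjacent, the swap relation is twice the word, and 2 is invertible. *)
Lemma repeated_even_word i s : even i -> (1 < count_mem i s)%N -> Rel (wd (bw s)).
Proof.
move=> ei hi.
have [s' hs'] : exists s', perm_eq s (i :: i :: s').
  have h1 : i \in s by rewrite -has_pred1 has_count; apply: ltn_trans hi.
  have p1 := perm_to_rem h1.
  have h2 : i \in rem i s.
    have := permP p1 (pred1 i); rewrite /= eqxx => hc.
    by rewrite -has_pred1 has_count; move: hi; rewrite hc.
  by exists (rem i (rem i s)); apply: (perm_trans p1); rewrite perm_cons perm_to_rem.
have [c hc] := perm_basis_word hs'.
apply: (submodule_subr (relS _ _) _ _).2 hc; apply: (submoduleZ (relS _ _)).
have hn : homogeneous [::] by [].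
have := rel_swap (theta := theta) hn (@basis_word_homogeneous s')
    (p := (deg i, vec i)) (q := (deg i, vec i)) (vec_deg i) (vec_deg i).
rewrite /= -[theta _ _]/(psi theta _) (eqP ei) scale1r => /(submoduleZ (relS _ _) 2^-1).
by rewrite -mulr2n -scaler_nat scalerA mulVf // scale1r.
Qed.

Section Trace.
Variables (x : degree) (n : nat).
Hypothesis size_le : forall s : seq degree, semisum s = Some x -> (size s <= n)%N.
Hypothesis coord_span : forall s : seq degree, semisum s = Some x ->
  forall y u, y \in s -> Lc y u -> u = \sum_(i | deg i == y) coord i u *: vec i.

Local Notation exponent := {ffun I -> 'I_n.+1}.

Definition nf (e : exponent) : seq I := flatten [seq nseq (e i) i | i <- enum I].

(** Exterior powers in the even letters, symmetric powers in the odd ones. *)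
Definition admissible (e : exponent) := [forall i, even i ==> (e i <= 1)%N].

Definition exponent_degree (e : exponent) := semisum [seq deg i | i <- nf e].

Definition monomials k : {set exponent} :=
  [set e | [&& admissible e, (\sum_i e i)%N == k & exponent_degree e == Some x]].

Lemma count_nf e i : count_mem i (nf e) = e i.
Proof.
rewrite /nf count_flatten -map_comp sumnE big_map big_enum /=.
rewrite (bigD1 i) //= count_nseq /= eqxx mul1n big1 ?addn0 // => j ji.
by rewrite count_nseq /= (negbTE ji).
Qed.

Lemma size_nf e : size (nf e) = (\sum_i e i)%N.
Proof.
rewrite /nf size_flatten /shape -map_comp sumnE big_map big_enum /=.
by apply: eq_bigr => i _; rewrite size_nseq.
Qed.

Lemma big_nf (R : Type) (idx : R) (op : Monoid.com_law idx) (g : I -> R) e :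
  \big[op/idx]_(i <- nf e) g i = \big[op/idx]_i iterop (e i) op (g i) idx.
Proof.
rewrite /nf big_flatten big_map big_enum /=; apply: eq_bigr => i _.
elim: {e}(nat_of_ord _) => [|m IH]; first by rewrite big_nil.
rewrite /= big_cons IH !Monoid.iteropE.
by case: m {IH} => //=; rewrite Monoid.mulm1.
Qed.

Lemma perm_nf (s : seq I) : (size s <= n)%N ->
  perm_eq s (nf [ffun i => inord (count_mem i s)]).
Proof.
move=> hs; apply/allP => i _ /=; rewrite count_nf ffunE inordK //.
by rewrite ltnS; apply: leq_trans hs; apply: count_size.
Qed.

Lemma perm_nf_eq e e' : perm_eq (nf e) (nf e') = (e == e').
Proof.
apply/idP/eqP => [h|->]; last exact: perm_refl.
by apply/ffunP => i; apply/val_inj; rewrite /= -!count_nf; apply: (permP h).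
Qed.

Variable f : {linear L -> L}.
Hypothesis f_Lc : forall y u, Lc y u -> Lc y (f u).
Variable ht : I -> nat.
Hypothesis f_triangular : forall i j, deg i = deg j ->
  coord i (f (vec j)) != 0 -> i = j \/ (ht i < ht j)%N.

Local Notation lam i := (coord i (f (vec i))).
Local Notation C := (chains Lc).
Local Notation R := (relations theta Lc).
Local Notation cm := (@chain_map F Gamma A L f).
Local Notation height s := (\sum_(i <- s) ht i)%N.

Lemma expand_map_low (M : lmodType F) (phi : seq I -> M) s :
  (forall t, (height t <= height s)%N -> phi t = 0) ->
  expand (map_word f (bw s)) phi = 0.
Proof.
elim: s phi => [|j s IH] phi h /=; first by apply: h.
apply: big1 => i /eqP ij; case: (eqVneq (coord i (f (vec j))) 0) => [->|ne].
  by rewrite scale0r.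
rewrite IH ?scaler0 // => t ht'; apply: h; rewrite !big_cons leq_add //.
by case: (f_triangular ij ne) => [->//|/ltnW].
Qed.

(* By triangularity every other term of the expansion has smaller height. *)
Lemma expand_map_diag (M : lmodType F) (phi : seq I -> M) s :
  (forall t, (height t < height s)%N -> phi t = 0) ->
  expand (map_word f (bw s)) phi = (\prod_(i <- s) lam i) *: phi s.
Proof.
elim: s phi => [|j s IH] phi h /=; first by rewrite big_nil scale1r.
rewrite (bigD1 j) //= [X in _ + X]big1 => [|i /andP [/eqP ij ne]].
  rewrite addr0 IH => [|t ht']; first by rewrite big_cons scalerA.
  by apply: h; rewrite !big_cons ltn_add2l.
case: (eqVneq (coord i (f (vec j))) 0) => [->|c0]; first by rewrite scale0r.
have hij : (ht i < ht j)%N.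
  by case: (f_triangular ij c0) => // e; rewrite e eqxx in ne.
rewrite expand_map_low ?scaler0 // => t ht'; apply: h.
by rewrite !big_cons -addSn leq_add.
Qed.

(** The admissible monomials form a basis of the chains modulo relations. They span since any basis
    word can be sorted or has a repeated even letter; they are free since [nfun a] kills the
    relations and, among the monomials [z b], is nonzero exactly on [z a]. *)
Lemma is_trace_chains k :
  is_trace (C k x) (R k x) cm (\sum_(e in monomials k) \prod_i lam i ^+ e i).
Proof.
pose z (a : 'I_#|monomials k|) := wd (bw (nf (enum_val a))) : words.
pose nfun (a : 'I_#|monomials k|) := functional (sign_functional (nf (enum_val a))).
have nfun_rel a Z : R k x Z -> nfun a Z = 0.
  move=> /relations_rel; apply: functional_rel; exact: sign_functional_alternating.
have sgn0 (a : 'I_#|monomials k|) : word_sign (nf (enum_val a)) != 0.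
  apply: word_sign_neq0 => i ei; rewrite count_nf.
  have := enum_valP a; rewrite inE => /and3P [/forallP /(_ i)].
  by rewrite ei.
have nfun_z a b : nfun a (z b) = word_sign (nf (enum_val a)) * (a == b)%:R.
  rewrite /nfun functional_wd expand_basis /sign_functional perm_nf_eq.
  by rewrite (inj_eq enum_val_inj) eq_sym; case: eqVneq => [->|]; rewrite ?mulr0.
have nfun_comb a c : nfun a (lincomb c z) = c 0 a * word_sign (nf (enum_val a)).
  have -> : nfun a (lincomb c z) = \sum_b c 0 b * nfun a (z b) :> F.
    by rewrite /nfun lincomb_linear.
  rewrite (bigD1 a) //= nfun_z eqxx mulr1 big1 ?addr0 // => b ba.
  by rewrite nfun_z eq_sym (negbTE ba) !mulr0.
have zC a : C k x (z a).
  have := enum_valP a; rewrite inE => /and3P [_ /eqP hk /eqP hx].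
  have := wd_ochains (@basis_word_homogeneous (nf (enum_val a))).
  rewrite size_map size_nf hk /word_degree -map_comp chainsE -hx.
  by congr (ochains _ _ _).
have zspan v : C k x v -> exists c : 'rV[F]_#|monomials k|, R k x (v - lincomb c z).
  (* Working modulo [Rel] spares the grading of intermediate words; [relationsP] restores [R k x] at
     the end. *)
  pose S := [set v | exists c : 'rV[F]_#|monomials k|, Rel (v - lincomb c z)].
  have hS : submodule S.
    split=> [|c u w [cu hu] [cw hw]].
      by exists 0; rewrite lincomb0 subrr; apply: submodule0 (relS _ _).
    exists (c *: cu + cw); rewrite lincombP.
    have := submoduleD (relS _ _) (submoduleZ (relS _ _) c hu) hw.
    by congr (Rel _); words_ring.
  have RS v' : Rel v' -> S v' by move=> h; exists 0; rewrite lincomb0 subr0.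
  have Sz a : S (z a).
    by exists (delta_mx 0 a); rewrite lincomb_delta subrr; apply: submodule0 (relS _ _).
  move=> hv; suff [c hc] : S v.
    have hC := ochainsS Lc k (Some x).
    exists c; apply/(relationsP Lie); split=> //; apply: (submoduleB hC) => //.
    by apply: (submodule_sum hC) => a _; apply: (submoduleZ hC); apply: zC.
  move: hv; rewrite chainsE; apply: ochains_ind => // w hk hx hw.
  have hD p : p \in w -> p.1 \in [seq p.1 | p <- w] by apply: map_f.
  have := wd_expand (coord_span hx) hw hD.
  move=> /RS h; rewrite -(subrK (expand w (fun s => wd (bw s))) (wd w)).
  apply: (submoduleD hS) => //; apply: expand_in => // s hs.
  have sk : size s = k by rewrite -hk -(size_map deg) hs size_map.
  have sx : semisum [seq deg i | i <- s] = Some x by rewrite hs.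
  have sn : (size s <= n)%N by rewrite -(size_map deg); apply: size_le.
  have hperm := perm_nf sn; set e := finfun _ in hperm.
  have [[i ei hi]|hne] := pselect (exists2 i, even i & (1 < count_mem i s)%N).
    by apply: RS; apply: repeated_even_word ei hi.
  have ae : admissible e.
    apply/forallP => i; apply/implyP => ei.
    rewrite -count_nf -(permP hperm) leqNgt; apply/negP => hi.
    by apply: hne; exists i.
  have em : e \in monomials k.
    rewrite inE ae -size_nf -(perm_size hperm) sk eqxx /=.
    by rewrite /exponent_degree -(semisum_perm (perm_map deg hperm)) sx.
  have [c hc] := perm_basis_word hperm.
  rewrite -(subrK (c *: wd (bw (nf e))) (wd (bw s))).
  apply: (submoduleD hS); first exact: RS.
  apply: (submoduleZ hS); have := Sz (enum_rank_in em e).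
  by rewrite /z enum_rankK_in.
have zfree : quotient_free (R k x) z.
  move=> c hc; apply/rowP => a; rewrite mxE.
  have := nfun_rel a _ hc; rewrite nfun_comb => /eqP.
  by rewrite mulf_eq0 (negbTE (sgn0 a)) orbF => /eqP.
have /choice [M hM] : forall a, exists c : 'rV[F]_#|monomials k|,
    R k x (cm (z a) - lincomb c z).
  by move=> a; apply: zspan; apply: chain_map_chains.
apply/is_traceE; exists #|monomials k|, z, (\matrix_a M a); split.
- exact: quotient_freeP (relationsS _ _ _ _) zfree zC zspan.
- by move=> a; rewrite rowK.
rewrite big_enum_val /mxtrace; apply: eq_bigr => a _; rewrite !mxE.
have nB u v : nfun a (u - v) = nfun a u - nfun a v by rewrite /nfun linearB.
(* The functional of [z a] isolates the diagonal entry [M a a]. It vanishes on words that do not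
   permute [z a], in particular on all words of smaller height, so the action contributes only the
   product of the [lam i]. *)
have := nfun_rel a _ (hM a); rewrite nB nfun_comb => /eqP.
rewrite subr_eq0 /nfun chain_map_wd functional_wd expand_map_diag => [|t ht']; last first.
  rewrite /sign_functional; case: (boolP (perm_eq t _)) => [hp|_]; last by rewrite mulr0.
  by rewrite (perm_big _ hp) ltnn in ht'.
rewrite /sign_functional perm_refl mulr1 => /eqP /(mulIf (sgn0 a)) <-.
rewrite big_nf; apply: eq_bigr => i _.
by rewrite Monoid.iteropE; elim: (nat_of_ord _) => [//|m IH]; rewrite exprS /= IH.
Qed.

End Trace.
End Monomials.

(** * Logarithms of products *)

Section LogarithmicDerivative.
Context {B : comNzRingType}.
Variable n : nat.
Implicit Types (f g p q : {poly B}).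

(* f' / f = g up to terms of degree at least n. *)
Definition logderiv f g := exists q, f^`() = f * g + q * 'X^n.

Lemma logderiv1 : logderiv 1 0.
Proof. by exists 0; rewrite derivC mulr0 mul0r addr0. Qed.

Lemma logderivM f1 f2 g1 g2 :
  logderiv f1 g1 -> logderiv f2 g2 -> logderiv (f1 * f2) (g1 + g2).
Proof.
move=> [q1 h1] [q2 h2]; exists (q1 * f2 + q2 * f1).
by rewrite derivM h1 h2; ring.
Qed.

Lemma geometric_poly (a : {poly B}) m :
  (1 - a) * (\sum_(d < m) a ^+ d) = 1 - a ^+ m.
Proof.
rewrite -[in RHS](expr1n _ m) subrXX; congr (_ * _).
by apply: eq_bigr => i _; rewrite expr1n mul1r.
Qed.

Lemma logderiv_linear (a : B) :
  logderiv (1 - a *: 'X) (- (a *: \sum_(d < n) (a *: 'X) ^+ d)).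
Proof.
exists (- (a ^+ n.+1)%:P).
rewrite mulrN -scalerAr geometric_poly derivB derivZ derivX derivC exprZn.
rewrite -!mul_polyC exprS !rmorphM /= !rmorphXn /=; ring.
Qed.

Lemma logderiv_geometric (a : B) :
  logderiv (\sum_(d < n.+1) (a *: 'X) ^+ d) (a *: \sum_(d < n) (a *: 'X) ^+ d).
Proof.
set f := \sum_(d < n.+1) _; set G := \sum_(d < n) _.
have hf : (1 - a *: 'X) * f = 1 - (a *: 'X) ^+ n.+1 by exact: geometric_poly.
have hG : (1 - a *: 'X) * G = 1 - (a *: 'X) ^+ n by exact: geometric_poly.
have := congr1 (fun p => p^`()) hf.
rewrite derivM !derivB !derivZ derivX derivC exprZn derivZ derivXn /= !sub0r => hd.
(* Obtained by multiplying [hd], the derivative of [hf], by [G] and replacing [(1 - a X) G] by its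
   value in [hG]. *)
exists (f^`() * (a ^+ n)%:P - (a ^+ n.+1)%:P * n.+1%:R * G).
have {}hG : G * (1 - a *: 'X) = 1 - (a ^+ n)%:P * 'X^n.
  by rewrite mulrC hG exprZn mul_polyC.
have {}hd : f^`() * (1 - a *: 'X) = a *: f - (a ^+ n.+1)%:P * n.+1%:R * 'X^n.
  move: hd; rewrite -!mul_polyC -mulr_natr => hd.
  have -> : f^`() * (1 - a%:P * 'X) =
    - (a%:P * 1) * f + (1 - a%:P * 'X) * f^`() + a%:P * f by ring.
  rewrite hd; ring.
transitivity (f^`() * (1 - a *: 'X) * G + f^`() * (a ^+ n)%:P * 'X^n).
  by rewrite -mulrA [_ * G]mulrC hG; ring.
by rewrite hd -!mul_polyC; ring.
Qed.

(** With [c r = 1 / (r + 1)] the sum is [- log f] truncated. As [1 - f] is divisible by ['X],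
    truncation costs only multiples of ['X^n], so [f] times the sum of [g] and the derivative of the
    truncated series is such a multiple; the constant term 1 of [f] allows cancelling it coefficient
    by coefficient. *)
Lemma logderiv_coef f g : logderiv f g -> f`_0 = 1 ->
  forall c : nat -> B, (forall r, c r * r.+1%:R = 1) ->
  forall d, (d < n)%N ->
  (\sum_(r < n) c r *: (1 - f) ^+ r.+1)`_d.+1 *+ d.+1 = - g`_d.
Proof.
move=> [q hq] f0 c hc; set W := \sum_(r < n) _.
have [h1 hh1] : exists h1, 1 - f = h1 * 'X.
  have : root (1 - f) 0 by rewrite /root horner_coef0 coefB coef1 f0 subrr.
  by case/factor_theorem => h1 ->; exists h1; rewrite subr0.
have dW : W^`() = \sum_(r < n) (1 - f)^`() * (1 - f) ^+ r.
  rewrite linear_sum; apply: eq_bigr => r _ /=.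
  by rewrite derivZ deriv_exp /= -scaler_nat scalerA hc scale1r.
have fW : f * (W^`() + g) = (q * (- 1 + h1 ^+ n * 'X^n) + f * g * h1 ^+ n ) * 'X^n.
  rewrite dW -mulr_sumr mulrDr mulrCA.
  have -> : f * (\sum_(r < n) (1 - f) ^+ r) = 1 - (h1 * 'X) ^+ n.
    by rewrite -hh1 -geometric_poly opprB addrCA subrr addr0.
  by rewrite derivB derivC sub0r hq exprMn; ring.
have key d : (d < n)%N -> (W^`() + g)`_d = 0.
  elim/ltn_ind: d => d IH dn.
  have := congr1 (fun p : {poly B} => p`_d) fW; rewrite /= coefMXn dn coefM.
  rewrite big_ord_recl /= f0 mul1r subn0 big1 ?addr0 // => i _.
  rewrite IH ?mulr0 // /bump; move: (ltn_ord i); lia.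
move=> d dn; have := key d dn; rewrite coefD coef_deriv => /eqP.
by rewrite addr_eq0 => /eqP.
Qed.

End LogarithmicDerivative.

(* Not imported earlier, since the notation << _ >> of freeg would be hidden. *)
From mathcomp Require Import monalg.

Lemma oadd_eq_None (S : addSemigroupType) (o1 o2 : option S) :
  oadd o1 o2 = None -> o1 = None /\ o2 = None.
Proof. by case: o1; case: o2. Qed.

HB.instance Definition _ (S : addSemigroupType) :=
  Choice_isMonomialDef.Build (option S) (@oaddA S) (@oadd0o S) (@oaddo0 S)
    (@oadd_eq_None S).
HB.instance Definition _ (S : addSemigroupType) :=
  MonomialDef_isConomialDef.Build (option S) (@oaddC S).

(** * Powers and logarithms in the algebra of the semigroup with adjoined unit *)

Section MonoidAlgebra.
Context {F : fieldType} {S : addSemigroupType}.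
Local Notation B := {malg F[option S]}.
Implicit Types (g : B) (o : option S).

Definition mon o : B := << o >>.

Lemma mon0 : mon None = 1. Proof. by []. Qed.

Lemma monD o1 o2 : mon (oadd o1 o2) = mon o1 * mon o2.
Proof. by rewrite malgM_def /mon fgmulUU mulr1. Qed.

Lemma mcoeff_mon o o' : (mon o)@_o' = (o == o')%:R.
Proof. exact: mcoeffU1. Qed.

Lemma monX o m : mon o ^+ m = mon (iterop m oadd o None).
Proof.
rewrite Monoid.iteropE.
by elim: m => [|m IH]; rewrite ?mon0 // exprS IH -monD.
Qed.

Fixpoint words_of (Y : seq S) r : seq (seq S) :=
  if r is r'.+1 then [seq y :: w | y <- Y, w <- words_of Y r'] else [:: [::]].

Lemma mem_words_of Y r w :
  (w \in words_of Y r) = (size w == r) && all (fun y => y \in Y) w.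
Proof.
elim: r w => [|r IH] [|y w] //=.
  by apply/allpairsP => -[[y w] /= []].
rewrite eqSS andbCA -IH; apply/allpairsP/andP => [[[y' w'] /= [h1 h2 [-> ->]]]|[h1 h2]] //.
by exists (y, w).
Qed.

Lemma words_ofS Y r :
  words_of Y r.+1 = [seq y :: w | y <- Y, w <- words_of Y r].
Proof. by []. Qed.

Arguments words_of : simpl never.

Lemma words_of_uniq Y r : uniq Y -> uniq (words_of Y r).
Proof.
move=> hY; elim: r => [//|r IH]; apply: allpairs_uniq => //.
by move=> [y w] [y' w'] _ _ /= [-> ->].
Qed.

Definition letters g : seq S := pmap id (msupp g).

Lemma letters_uniq g : uniq (letters g).
Proof. by apply: (@pmap_uniq _ _ id Some); [case | apply: fset_uniq]. Qed.

Lemma mem_letters g y : (y \in letters g) = (g@_(Some y) != 0).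
Proof. by rewrite mcoeff_neq0 /letters mem_pmap map_id. Qed.

Lemma malg_letters g : g@_None = 0 ->
  g = \sum_(y <- letters g) g@_(Some y) *: mon (Some y).
Proof.
move=> g0; apply/malgP => -[z|]; rewrite raddf_sum /=; last first.
  by rewrite g0 big1 // => y _; rewrite mcoeffZ mcoeff_mon mulr0.
under eq_bigr do rewrite mcoeffZ mcoeff_mon.
case: (boolP (z \in letters g)) => hz.
  rewrite (bigD1_seq z) ?letters_uniq //= eqxx mulr1 big1 ?addr0 // => y yz.
  by rewrite (inj_eq Some_inj) (negbTE yz) mulr0.
rewrite big1_seq; first by move: hz; rewrite mem_letters negbK => /eqP.
move=> y /= hy; case: eqP => [[e]|]; rewrite ?mulr0 //.
by rewrite -e hy in hz.
Qed.

Lemma malg_exp_words g r : g@_None = 0 ->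
  g ^+ r = \sum_(w <- words_of (letters g) r)
    (\prod_(y <- w) g@_(Some y)) *: mon (semisum w).
Proof.
move=> g0; elim: r => [|r IH].
  by rewrite expr0 big_seq1 big_nil scale1r.
rewrite exprS IH {1}(malg_letters g0) words_ofS big_allpairs_dep mulr_suml.
apply: eq_bigr => y _; rewrite mulr_sumr; apply: eq_bigr => w _.
by rewrite -scalerAl -scalerAr scalerA big_cons semisum_cons monD.
Qed.

(* The sum over words that computes the degree x part of -log (1 - g). *)
Lemma malg_log_words g (h : S -> F) x n : g@_None = 0 ->
  (forall w, semisum w = Some x -> (size w <= n)%N) ->
  (forall w, semisum w = Some x -> forall y, y \in w -> h y = g@_(Some y)) ->
  \sum_(w \in [set w | semisum w = Some x])
     (size w)%:R^-1 * \prod_(y <- w) h y =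
  (\sum_(r < n) r.+1%:R^-1 *: g ^+ r.+1)@_(Some x).
Proof.
move=> g0 hn hh.
pose Ws := [seq w <- flatten [seq words_of (letters g) r.+1 | r <- iota 0 n]
              | semisum w == Some x].
have memWs w : (w \in Ws) =
    [&& semisum w == Some x, (size w <= n)%N, (0 < size w)%N
      & all (fun y => y \in letters g) w].
  rewrite mem_filter; congr (_ && _); apply/flatten_mapP/and3P.
    move=> [r]; rewrite mem_iota add0n => rn.
    by rewrite mem_words_of => /andP [/eqP -> ->].
  case: w => [[]//|y w [h1 _ h2]]; exists (size w); first by rewrite mem_iota.
  by rewrite mem_words_of eqxx.
have uniqWs : uniq Ws.
  apply: filter_uniq; elim: n {hn Ws memWs} 0%N => [//|n IH] m.
  rewrite /=.
  rewrite cat_uniq words_of_uniq ?letters_uniq // IH andbT andTb.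
  apply/hasPn => w /flatten_mapP [r]; rewrite mem_iota => /andP [mr _].
  rewrite !mem_words_of => /andP [/eqP -> _]; rewrite eqSS.
  by rewrite negb_and gtn_eqF.
(* The words of degree [x] missing from [Ws] have a letter outside the support of [g], so their
   product vanishes. *)
rewrite (fsbigE Ws) //; last first.
- move=> w /= hw; rewrite memWs hw eqxx hn //=.
  have -> /= : (0 < size w)%N by case: w hw.
  move=> /allPn [z hz]; rewrite mem_letters negbK => /eqP hz0.
  suff -> : \prod_(y <- w) h y = 0 by rewrite mulr0.
  by apply/eqP; rewrite prodf_seq_eq0; apply/hasP; exists z; rewrite //= (hh _ hw) ?hz0.
- by move=> w /=; rewrite memWs => /and4P [/eqP].
have -> : \sum_(w <- Ws | w \in [set w | semisum w = Some x])
    (size w)%:R^-1 * \prod_(y <- w) h y =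
    \sum_(w <- Ws) (size w)%:R^-1 * \prod_(y <- w) g@_(Some y).
  rewrite [LHS]big_mkcond; apply: eq_big_seq => w.
  rewrite memWs => /and4P [/eqP hw _ _ _]; rewrite ifT ?inE //.
  by congr (_ * _); apply: eq_big_seq => y yw; apply: hh hw _ yw.
rewrite big_filter big_flatten big_map.
have -> : iota 0 n = index_iota 0 n by rewrite /index_iota subn0.
rewrite big_mkord raddf_sum; apply: eq_bigr => r _ /=.
rewrite mcoeffZ malg_exp_words // raddf_sum mulr_sumr big_mkcond.
apply: eq_big_seq => w; rewrite mem_words_of => /andP [/eqP -> _] /=.
by rewrite mcoeffZ mcoeff_mon; case: eqP => _; rewrite ?mulr1 ?mulr0.
Qed.

End MonoidAlgebra.

(** * Finite Euler products and their logarithms *)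

Section EulerProduct.
Context {F : fieldType} {S : addSemigroupType}.
Local Notation B := {malg F[option S]}.
Hypothesis F0 : forall r, r.+1%:R != 0 :> F.
Variables (I : finType) (deg : I -> S) (lam : I -> F) (even : pred I).
Variables (x : S) (n : nat).
Hypothesis size_le : forall w : seq S, semisum w = Some x -> (size w <= n)%N.

Definition sgn i : F := if even i then 1 else -1.

Definition scaled_mon i : B := lam i *: mon (Some (deg i)).
Local Notation a := scaled_mon.

(* The second factor is (1 - a i *: 'X)^-1 truncated in degree n. *)
Definition factor i : {poly B} :=
  if even i then 1 - a i *: 'X else \sum_(d < n.+1) (a i *: 'X) ^+ d.

Definition euler_product : {poly B} := \prod_i factor i.
Local Notation P := euler_product.

Definition inv_nat r : B := (r.+1%:R^-1 : F)%:MP.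

Definition log_poly : {poly B} := \sum_(r < n) inv_nat r *: (1 - P) ^+ r.+1.

Lemma inv_natK r : inv_nat r * r.+1%:R = 1.
Proof. by rewrite /inv_nat -mpolyC_nat -rmorphM /= mulVf ?F0 // mpolyC1E. Qed.

Lemma euler_product_coef0 : P`_0 = 1.
Proof.
rewrite -horner_coef0 /P horner_prod big1 // => i _.
rewrite /factor; case: ifP => _; first by rewrite !hornerE; ring.
rewrite horner_sum big_ord_recl expr0 hornerE big1 ?addr0 // => d _.
by rewrite horner_exp !hornerE /bump /= ?exprS ?mulr0 ?mul0r. 
Qed.

(** Logarithmic derivatives add over the factors, and each factor is geometric, which yields signed
    power sums of the [a i]. *)
Lemma log_poly_coef d : (d < n)%N ->
  log_poly`_d.+1 *+ d.+1 = \sum_i sgn i *: a i ^+ d.+1.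
Proof.
move=> dn.
pose Q i : {poly B} := if even i then - (a i *: \sum_(d < n) (a i *: 'X) ^+ d)
             else a i *: \sum_(d < n) (a i *: 'X) ^+ d.
have hP : logderiv n P (\sum_i Q i).
  apply: (big_ind2 (logderiv n)); first exact: logderiv1.
    by move=> *; apply: logderivM.
  move=> i _; rewrite /Q /factor; case: ifP => _.
    exact: logderiv_linear.
  exact: logderiv_geometric.
rewrite (logderiv_coef hP euler_product_coef0 inv_natK) //.
rewrite coef_sum -sumrN; apply: eq_bigr => i _.
have geo : (a i *: \sum_(d < n) (a i *: 'X) ^+ d)`_d = a i ^+ d.+1.
  rewrite coefZ coef_sum (bigD1 (Ordinal dn)) //= exprZn coefZ coefXn eqxx mulr1.
  rewrite big1 ?addr0 ?exprS // => j jd; rewrite exprZn coefZ coefXn.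
  by case: eqP => [e|]; rewrite ?mulr0 //; rewrite -val_eqE /= e eqxx in jd.
rewrite /Q /sgn; case: ifP => _; first by rewrite coefN geo opprK scale1r.
by rewrite geo scaleN1r.
Qed.

(* The coefficient of 'X^k lives on sums of k degrees. *)
Definition homog (p : {poly B}) := forall k o,
  (forall s : seq S, size s = k -> semisum s <> o) -> (p`_k)@_o = 0.

Lemma homogD p q : homog p -> homog q -> homog (p + q).
Proof. by move=> hp hq k o h; rewrite coefD mcoeffD hp ?hq ?addr0. Qed.

Lemma homogC c p : homog p -> homog (c%:MP *: p).
Proof. by move=> hp k o h; rewrite coefZ mcoeffCM hp // mulr0. Qed.

Lemma homogN p : homog p -> homog (- p).
Proof. by move=> hp k o h; rewrite coefN mcoeffN hp // oppr0. Qed.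

Lemma homog0 : homog 0.
Proof. by move=> k o _; rewrite coef0 mcoeff0. Qed.

Lemma homog1 : homog 1.
Proof.
move=> [|k] o h; rewrite coef1 ?mcoeff0 // mcoeff1.
by case: eqP => // oE; have := h [::] erefl; rewrite oE.
Qed.

Lemma homogM p q : homog p -> homog q -> homog (p * q).
Proof.
move=> hp hq k o h; rewrite coefM raddf_sum big1 // => j _ /=.
rewrite mcoeffMl big1 // => k1 _; rewrite big1 // => k2 _.
case: eqP => // e; rewrite mulr1n.
have [[s1 h1 e1]|n1] := pselect (exists2 s1 : seq S, size s1 = j & semisum s1 = k1); last first.
  by rewrite hp ?mul0r // => s h1 h2; apply: n1; exists s.
rewrite (hq _ k2) ?mulr0 // => s2 h2 e2; apply: (h (s1 ++ s2)).
  by rewrite size_cat h1 h2 subnKC // -ltnS.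
by rewrite semisum_cat e1 e2.
Qed.

Lemma homogX p m : homog p -> homog (p ^+ m).
Proof.
move=> hp; elim: m => [|m IH]; first exact: homog1.
by rewrite exprS; apply: homogM.
Qed.

Lemma homog_factor i : homog (factor i).
Proof.
have ha : homog (a i *: 'X).
  move=> k o h; rewrite coefZ coefX; case: eqP => [k1|_]; last by rewrite mulr0 mcoeff0.
  rewrite mulr1 mcoeffZ mcoeff_mon; case: eqP => [e|_]; last by rewrite mulr0.
  by have := h [:: deg i]; rewrite k1 /= e => /(_ erefl).
rewrite /factor; case: ifP => _; first by apply: homogD; [apply: homog1 | apply: homogN].
by apply: big_ind; [exact: homog0 | exact: homogD | move=> d _; apply: homogX].
Qed.

Lemma homog_log_poly : homog log_poly.
Proof.
apply: big_ind; [exact: homog0 | exact: homogD | move=> r _].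
apply/homogC/homogX/homogD/homogN; first exact: homog1.
by apply: big_ind; [exact: homog1 | exact: homogM | move=> i _; apply: homog_factor].
Qed.

Lemma log_poly_eval : log_poly.[1] = \sum_(r < n) r.+1%:R^-1 *: (1 - P.[1]) ^+ r.+1.
Proof.
rewrite horner_sum; apply: eq_bigr => r _.
by rewrite hornerZ horner_exp hornerD hornerN hornerC /inv_nat mul_malgC.
Qed.

(** Setting ['X] to 1 forgets the number of factors. For the degree [x] nothing is lost: by
    homogeneity only the powers of ['X] from 1 to [n], where the coefficients are known, can
    contribute. *)
Lemma log_poly_mcoeff : (log_poly.[1])@_(Some x) =
  \sum_(d < n) d.+1%:R^-1 *
    \sum_i sgn i * lam i ^+ d.+1 * (iterop d.+1 oadd (Some (deg i)) None == Some x)%:R.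
Proof.
(* The bound exceeds both [n], where the sum will be cut, and the size of the polynomial. *)
rewrite (@horner_coef_wide _ (n + size log_poly).+1); last by rewrite ltnW // ltnS leq_addl.
rewrite big_ord_recl /= expr1n mulr1.
have -> : log_poly`_0 = 0.
  rewrite coef_sum big1 // => r _; rewrite coefZ -horner_coef0 horner_exp.
  by rewrite hornerD hornerN hornerC horner_coef0 euler_product_coef0 subrr exprS mul0r mulr0.
rewrite add0r raddf_sum /=.
rewrite -(big_mkord xpredT (fun i => (log_poly`_i.+1 * 1 ^+ i.+1)@_(Some x))).
rewrite (@big_cat_nat _ _ _ n) //= ?leq_addr // [X in _ + X]big_nat_cond.
rewrite [X in _ + X]big1 ?addr0 => [|i /andP [/andP [ni _] _]]; last first.
  rewrite expr1n mulr1; apply: homog_log_poly => s hs /size_le.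
  by rewrite hs ltnNge ni.
rewrite big_mkord; apply: eq_bigr => d _; rewrite expr1n mulr1.
have := congr1 (mcoeff (Some x)) (log_poly_coef (ltn_ord d)).
rewrite mcoeffMn => h.
apply: (mulfI (F0 d)); rewrite mulr_natl h mulrA mulfV ?F0 // mul1r.
rewrite raddf_sum; apply: eq_bigr => i _ /=.
by rewrite mcoeffZ /a exprZn mcoeffZ monX mcoeff_mon mulrA.
Qed.

Local Notation exponent := {ffun I -> 'I_n.+1}.

Definition monomial_degree (e : exponent) : option S :=
  \big[oadd/None]_i iterop (e i) oadd (Some (deg i)) None.

Lemma factor_eval i : (0 < n)%N -> (factor i).[1] =
  \sum_(d < n.+1 | even i ==> (d <= 1)%N)
    ((- sgn i * lam i) *: mon (Some (deg i))) ^+ d.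
Proof.
rewrite /factor /sgn; case: ifP => ei /= n0; last first.
  rewrite horner_sum; apply: eq_bigr => d _.
  by rewrite horner_exp hornerZ hornerX mulr1 opprK mul1r.
rewrite hornerD hornerN hornerZ hornerX hornerC mulr1 mulN1r scaleNr.
case: n n0 => // m _; rewrite big_mkcond !big_ord_recl /= expr0 expr1 big1 ?addr0 //.
Qed.

Lemma euler_product_mcoeff o : (0 < n)%N -> (P.[1])@_o =
  \sum_(e : exponent | [forall i, even i ==> (e i <= 1)%N] && (monomial_degree e == o))
    \prod_i (- sgn i * lam i) ^+ e i.
Proof.
move=> n0; rewrite horner_prod.
under eq_bigr do rewrite factor_eval //.
rewrite bigA_distr_big_dep raddf_sum big_mkcond [RHS]big_mkcond.
apply: eq_bigr => e _ /=.
rewrite inE /=; case: forallP => _ /=; last by [].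
have -> : \prod_i ((- sgn i * lam i) *: mon (Some (deg i))) ^+ e i =
    (\prod_i (- sgn i * lam i) ^+ e i) *: mon (monomial_degree e).
  rewrite /monomial_degree.
  apply: (big_rec3 (fun (p : B) (c : F) o' => p = c *: mon o')).
    by rewrite scale1r.
  move=> i p c o' _ ->; rewrite exprZn monX monD.
  by rewrite -scalerAl -scalerAr scalerA.
by rewrite mcoeffZ mcoeff_mon; case: eqP => _; rewrite ?mulr1 ?mulr0.
Qed.

Lemma euler_product_mcoeff_None : (1 - P.[1])@_None = 0.
Proof.
rewrite mcoeffB mcoeff1 eqxx horner_prod.
(* The coefficient of the unit is multiplicative, because [None] is a sum of two elements only when
   both are [None]. *)
pose ev : {rmorphism B -> F} := mcoeff (@mone (option S)).
rewrite -[(\prod_i _)@_None]/(ev _) rmorph_prod big1 ?subrr // => i _.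
have ea : ev (a i) = 0 by rewrite /ev /= mcoeffZ mcoeff_mon mulr0.
rewrite /factor; case: ifP => _.
  by rewrite hornerD hornerN hornerZ hornerX hornerC mulr1 rmorphB rmorph1 ea subr0.
rewrite horner_sum rmorph_sum big_ord_recl expr0 hornerC rmorph1 big1 ?addr0 // => d _.
by rewrite horner_exp hornerZ hornerX mulr1 rmorphXn ea /= exprS mul0r.
Qed.

Lemma log_words_euler (h : S -> F) : (0 < n)%N ->
  (forall w, semisum w = Some x -> forall y, y \in w ->
    h y = - \sum_(e : exponent |
               [forall i, even i ==> (e i <= 1)%N] && (monomial_degree e == Some y))
               \prod_i (- sgn i * lam i) ^+ e i) ->
  \sum_(w \in [set w | semisum w = Some x])
     (size w)%:R^-1 * \prod_(y <- w) h y =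
  \sum_(d < n) d.+1%:R^-1 *
    \sum_i sgn i * lam i ^+ d.+1 * (iterop d.+1 oadd (Some (deg i)) None == Some x)%:R.
Proof.
move=> n0 hh; rewrite -log_poly_mcoeff log_poly_eval.
apply: malg_log_words => [|//|w hw y yw]; first exact: euler_product_mcoeff_None.
by rewrite (hh w) // mcoeffB mcoeff1 sub0r euler_product_mcoeff.
Qed.

End EulerProduct.

(** * Witt partition functions and Moebius inversion *)

Section WordCount.
Context {T : choiceType}.
Implicit Types (s t D : seq T).

Lemma sum_count s D : uniq D -> {subset s <= D} ->
  (\sum_(x <- D) count_mem x s)%N = size s.
Proof.
move=> uD; elim: s => [|x s IH] sD; first by rewrite big1.
have xD : x \in D by apply: sD; rewrite mem_head.
rewrite /= big_split /= IH => [|y ys]; last by apply: sD; rewrite inE ys orbT.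
rewrite (bigD1_seq x xD uD) /= eqxx big1 ?addn0 // => y.
by rewrite eq_sym => /negbTE ->.
Qed.

(** The multinomial coefficient, by induction on the first letter: removing [x] lowers its
    multiplicity by one, and the multiplicities of the possible first letters add up to the
    length. *)
Lemma size_permutations_mul s D : uniq D -> {subset s <= D} ->
  (size (permutations s) * \prod_(y <- D) (count_mem y s)`! = (size s)`!)%N.
Proof.
move=> uD; move Dn: (size s) => n; elim: n s Dn => [|n IH] s Dn sD.
  by case: s Dn sD => // _ _; rewrite big1 // => y _; rewrite fact0.
have s0 : (0 < size s)%N by rewrite Dn.
rewrite (perm_size (permutationsE s0)) size_allpairs_dep sumnE big_map.
rewrite big_distrl /= factS -Dn -(@sum_count s (undup s)) ?undup_uniq //; last first.
  by move=> y; rewrite mem_undup.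
rewrite big_distrl /=.
apply: eq_big_seq => x; rewrite mem_undup => xs.
rewrite -(IH (rem x s)); first last.
- by move=> y /mem_rem /sD.
- by rewrite size_rem // Dn.
rewrite mulnCA; congr (_ * _)%N.
have xD := sD _ xs.
rewrite !(bigD1_seq x xD uD) /= mulnA.
have cE y : count_mem y (rem x s) = (count_mem y s - (y == x))%N.
  have := permP (perm_to_rem xs) (pred1 y); rewrite /= [x == y]eq_sym => ->.
  by rewrite addKn.
have cx : (0 < count_mem x s)%N by rewrite -has_count has_pred1.
rewrite cE eqxx subn1 -{1}(prednK cx) factS prednK //; congr (_ * _)%N.
by apply: eq_bigr => y yx; rewrite cE (negbTE yx) subn0.
Qed.

Lemma prod_count (R : comNzRingType) (h : T -> R) s D : uniq D -> {subset s <= D} ->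
  \prod_(y <- s) h y = \prod_(y <- D) h y ^+ count_mem y s.
Proof.
move=> uD; elim: s => [|x s IH] sD.
  by rewrite big_nil big1 // => y _; rewrite expr0.
have xD : x \in D by apply: sD; rewrite mem_head.
rewrite big_cons IH => [|y ys]; last by apply: sD; rewrite inE ys orbT.
rewrite !(bigD1_seq x xD uD) /= eqxx add1n exprS mulrA; congr (_ * _).
by apply: eq_bigr => y yx; rewrite [x == y]eq_sym (negbTE yx).
Qed.

Lemma big_fiber (R : nmodType) (J : eqType) (m : T -> J) s (G : T -> R) :
  \sum_(w <- s) G w = \sum_(j <- undup (map m s)) \sum_(w <- s | m w == j) G w.
Proof.
under [RHS]eq_bigr do rewrite big_mkcond.
rewrite exchange_big /=; apply: eq_big_seq => w ws.
rewrite (bigD1_seq (m w)) ?undup_uniq ?mem_undup ?map_f //= eqxx big1 ?addr0 // => j.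
by rewrite eq_sym => /negbTE ->.
Qed.

End WordCount.

Section WittPartition.
Context {F : fieldType} {Gamma : addSemigroupType} {A : zmodType}.
Local Notation degree := (Gamma * A)%type.
Hypothesis F0 : forall r, r.+1%:R != 0 :> F.

Lemma count_enum_mset (s : multiset degree) y : count_mem y (enum_mset s) = s y.
Proof. by rewrite -mset_seqE seq_mset_id. Qed.

Lemma finsuppE (s : multiset degree) : perm_eq (finsupp s) (undup (enum_mset s)).
Proof.
apply: uniq_perm; rewrite ?fset_uniq ?undup_uniq // => y.
by rewrite mem_undup mem_finsupp -count_enum_mset -has_pred1 has_count lt0n.
Qed.

Lemma fact_neq0 m : m`!%:R != 0 :> F.
Proof. by case: m`! (fact_gt0 m) => // r _; apply: F0. Qed.

(** The weight of a partition is the number of its orderings divided by its size, so summing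
    [1 / size] over ordered words gives the same value, and ordered words are what powers of a
    series produce. *)
Lemma witt_partition_words (h : degree -> F) x :
  finite_set [set s : seq degree | semisum s = Some x] ->
  witt_partition h x = \sum_(w \in [set w | semisum w = Some x])
     (size w)%:R^-1 * \prod_(y <- w) h y.
Proof.
move=> finW; pose U : seq (seq degree) := fset_set [set s : seq degree | semisum s = Some x].
have memU w : (w \in U) = (semisum w == Some x).
  by rewrite in_fset_set //; apply/idP/eqP => hw; [rewrite inE in hw | rewrite inE].
rewrite fsbig_finite // -/U (big_fiber (seq_mset (K := degree))).
pose V := undup (map (@seq_mset _) U).
have memV s : (s \in V) = (semisum (enum_mset s) == Some x).
  rewrite mem_undup; apply/mapP/eqP => [[w]|hs].
    by rewrite memU => /eqP <- ->; apply/semisum_perm/perm_eq_seq_mset.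
  by exists (enum_mset s); rewrite ?memU ?hs ?seq_mset_id.
rewrite /witt_partition (@fsbig_fwiden _ _ _ _ V); last first.
- move=> s [/= sV /not_andP [ns|]]; last by move: sV; rewrite memV => /eqP ->.
  have [y ys hy] : exists2 y, y \in finsupp s & h y = 0.
    apply: contrapT => hn; apply: ns => y ys; apply/negP => /eqP hy.
    by apply: hn; exists y.
  suff e : \prod_(y <- finsupp s) h y ^+ s y = 0 by rewrite /= e mulr0.
  apply/eqP; rewrite prodf_seq_eq0; apply/hasP; exists y => //=.
  by move: ys; rewrite mem_finsupp hy expr0n => /negbTE ->.
- exact: undup_uniq.
- by move=> s [_ hs] /=; rewrite memV hs.
apply: eq_big_seq => s; rewrite memV => /eqP hs.
have -> : \sum_(w <- U | seq_mset w == s) (size w)%:R^-1 * \prod_(y <- w) h y =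
  \sum_(w <- permutations (enum_mset s)) (size w)%:R^-1 * \prod_(y <- w) h y.
  rewrite -big_filter; apply: perm_big; apply: uniq_perm.
  - by apply: filter_uniq; apply: fset_uniq.
  - exact: permutations_uniq.
  move=> w; rewrite mem_filter memU mem_permutations.
  rewrite -{1}[s]seq_mset_id; apply/andP/idP => [[/eqP/eq_seq_msetP]|hw] //.
  by split; [apply/eqP/eq_seq_msetP | rewrite (semisum_perm hw) hs].
have subf : {subset enum_mset s <= finsupp s}.
  by move=> y; rewrite (perm_mem (finsuppE s)) mem_undup.
have prodE : \prod_(y <- enum_mset s) h y = \prod_(y <- finsupp s) h y ^+ s y.
  rewrite (prod_count h (fset_uniq _) subf).
  by apply: eq_bigr => y _; rewrite count_enum_mset.
rewrite [RHS](eq_big_seq (fun=>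
  (size (enum_mset s))%:R^-1 * \prod_(y <- enum_mset s) h y)); last first.
  move=> w; rewrite mem_permutations => hw.
  by rewrite (perm_size hw) (perm_big _ hw).
rewrite big_const_seq count_predT iter_addr_0 prodE -[RHS]mulr_natl mulrA; congr (_ * _).
have s0 : (0 < size (enum_mset s))%N by case: (enum_mset s) hs.
have := size_permutations_mul (fset_uniq _) subf.
under eq_bigr do rewrite count_enum_mset.
case: (size (enum_mset s)) s0 (size (permutations _)) => [//|r] _ N.
rewrite /= factS => e; rewrite -[LHS]mul1r.
have e' : N%:R * (\prod_(y <- finsupp s) (s y)`!)%:R = r.+1%:R * r`!%:R :> F by rewrite -!natrM e.
have p0 : (\prod_(y <- finsupp s) (s y)`!)%:R != 0 :> F.
  rewrite natr_prod prodf_seq_neq0; apply/allP => y _; exact: fact_neq0.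
apply: (mulIf p0); rewrite mul1r mulfVK // mulrAC e'.
by rewrite mulrAC mulfV ?F0 // mul1r.
Qed.

End WittPartition.

Section Mobius.
Local Open Scope nat_scope.

Lemma mobius_prime_mul p e : prime p -> 0 < e -> ~~ (p %| e) ->
  mobius (p * e) = (- mobius e)%R.
Proof.
move=> pp e0 pe.
have p0 := prime_gt0 pp.
have hperm : perm_eq (primes (p * e)) (p :: primes e).
  apply: uniq_perm; rewrite ?primes_uniq //=.
    by rewrite primes_uniq mem_primes (negbTE pe) !andbF.
  by move=> q; rewrite primesM // primes_prime // !inE.
rewrite /mobius (perm_size hperm) (perm_all _ hperm) /= lognM // logn_prime // eqxx.
have -> : logn p e = 0 by apply/eqP; rewrite lognE pp e0 (negbTE pe).
rewrite addn0 eqxx /=.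
have -> : all (fun q => logn q (p * e) == 1) (primes e) =
          all (fun q => logn q e == 1) (primes e).
  apply: eq_in_all => q; rewrite mem_primes => /and3P [qp _ qe].
  rewrite lognM // logn_prime //; case: (eqVneq q p) => [eqpq|] //.
  by rewrite -eqpq qe in pe.
by case: ifP => _; rewrite ?GRing.oppr0 // GRing.exprS GRing.mulN1r.
Qed.

Lemma mobius_square p d : prime p -> 0 < d -> p %| d -> p %| d %/ p ->
  mobius d = 0%R.
Proof.
move=> pp d0 pd pdp; rewrite /mobius; case: ifP => // /allP /(_ p).
rewrite mem_primes pp d0 pd => /(_ isT) /eqP h.
have : p ^ 2 %| d by rewrite -(divnK pd) mulnC dvdn_pmul2l // prime_gt0.
by rewrite pfactor_dvdn // h.
Qed.

(** Let [p] be a prime factor of [n]. Divisors divisible by the square of [p] contribute 0, and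
    those divisible by [p] just once are the [p * e] with [e] in [K], the divisors prime to [p],
    whose terms they cancel. *)
Lemma sum_mobius n : 0 < n ->
  (\sum_(d <- divisors n) mobius d)%R = ((n == 1)%:R)%R :> int.
Proof.
move=> n0; case: (ltngtP n 1) => [|n1|->]; first by case: n n0.
  have pp := pdiv_prime n1; set p := pdiv n in pp *.
  have pn : p %| n by apply: pdiv_dvd.
  have p0 := prime_gt0 pp.
  rewrite (bigID (fun d => p %| d)) /=.
  pose K := [seq d <- divisors n | ~~ (p %| d)].
  have -> : (\sum_(d <- divisors n | (p %| d)%N) mobius d)%R =
            (\sum_(d <- map (muln p) K) mobius d)%R.
    rewrite -big_filter (bigID (fun d => p %| d %/ p)) /= big1_seq ?GRing.add0r.
      rewrite -big_filter; apply: perm_big; apply: uniq_perm.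
      - by do 2!apply: filter_uniq; apply: divisors_uniq.
      - rewrite map_inj_uniq ?filter_uniq ?divisors_uniq // => a b /eqP.
        by rewrite eqn_pmul2l // => /eqP.
      move=> d; rewrite !mem_filter -dvdn_divisors //; apply/and3P/mapP.
        move=> [h1 h2 h3]; exists (d %/ p); last by rewrite mulnC divnK.
        rewrite mem_filter h1 -dvdn_divisors //=.
        by apply: dvdn_trans h3; rewrite -{2}(divnK h2) dvdn_mulr.
      move=> [e]; rewrite mem_filter -dvdn_divisors // => /andP [h1 h2] ->.
      rewrite mulKn // h1 dvdn_mulr //; split=> //.
      rewrite -(divnK pn) mulnC dvdn_pmul2r //.
      have : e %| n %/ p * p by rewrite divnK.
      by rewrite Gauss_dvdl // coprime_sym prime_coprime.
    move=> d /andP [h1]; rewrite mem_filter -dvdn_divisors // => /andP [h2 h3].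
    by apply: (mobius_square pp _ h2 h1); apply: dvdn_gt0 h3.
  rewrite big_map -[X in (_ + X)%R]big_filter -/K.
  rewrite -big_split big1_seq //= => e; rewrite mem_filter -dvdn_divisors //.
  move=> /andP [h1 h2]; rewrite mobius_prime_mul ?GRing.addNr //.
  exact: dvdn_gt0 h2.
by rewrite /divisors /= big_seq1.
Qed.

End Mobius.

(** * Moebius inversion over a semigroup *)

Section MobiusInversion.
Context {F : fieldType} {S : addSemigroupType}.
Hypothesis fd : finitely_decomposable S.

Definition omul d (o : option S) := iter d (oadd o) None.

Lemma omulD d e o : omul (d + e) o = oadd (omul d o) (omul e o).
Proof. by elim: d => [//|d IH]; rewrite /omul /= -!/(omul _ _) IH oaddA. Qed.

Lemma omulM d e o : omul (d * e) o = omul d (omul e o).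
Proof.
by elim: d => [//|d IH]; rewrite mulSn omulD IH.
Qed.

Lemma Some_semimul d (y : S) : (0 < d)%N -> Some (semimul d y) = omul d (Some y).
Proof.
case: d => // d _; rewrite /semimul succnK; elim: d => [//|d IH].
by rewrite -[RHS]/(oadd (Some y) (omul d.+1 (Some y))) -IH.
Qed.

Lemma semimulM d e (y : S) : (0 < d)%N -> (0 < e)%N ->
  semimul d (semimul e y) = semimul (d * e) y.
Proof.
move=> d0 e0; apply: Some_inj.
by rewrite !Some_semimul ?muln_gt0 ?d0 // omulM.
Qed.

Lemma semisum_nseq d (y : S) : semisum (nseq d y) = omul d (Some y).
Proof. by elim: d => [//|d IH]; rewrite /= IH. Qed.

Lemma semimul1 (y : S) : semimul 1 y = y. Proof. by []. Qed.

Section Bounds.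
Variable x : S.

Lemma decomposition_bounds : exists n (D : seq S), [/\ (0 < n)%N, uniq D &
  forall w : seq S, semisum w = Some x -> (size w <= n)%N /\ {subset w <= D}].
Proof.
have /finite_fsetP [U hU] := fd x.
have memU w : semisum w = Some x -> w \in U.
  by move=> h; have : [set s | semisum s = Some x] w by []; rewrite hU.
exists (\max_(w <- U) size w)%N, (undup (flatten U)).
have bound w : semisum w = Some x -> (size w <= \max_(w <- U) size w)%N.
  by move=> /memU h; rewrite (big_rem w h) leq_maxl.
split=> [||w hw]; first by have := bound [:: x] erefl; apply: leq_trans.
  exact: undup_uniq.
split=> [|y yw]; first exact: bound.
by rewrite mem_undup; apply/flattenP; exists w => //; apply: memU.
Qed.

End Bounds.

Variables (x : S) (n : nat) (D : seq S).
Hypothesis uD : uniq D.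
Hypothesis bounds :
  forall w : seq S, semisum w = Some x -> (size w <= n)%N /\ {subset w <= D}.

(** The bounds are applied to the word consisting of [d] copies of [y]. *)
Lemma semimul_bounds d y : (0 < d)%N -> x = semimul d y -> (d <= n)%N /\ y \in D.
Proof.
move=> d0 e; have := @bounds (nseq d y); rewrite semisum_nseq -Some_semimul // -e.
move=> /(_ erefl) []; rewrite size_nseq => -> h; split=> //; apply: h.
by rewrite mem_nseq d0 eqxx.
Qed.

Lemma fsbig_multiples (G : nat * S -> F) :
  \sum_(p \in [set p : nat * S | (0 < p.1)%N /\ x = semimul p.1 p.2]) G p =
  \sum_(1 <= d < n.+1) \sum_(y <- D | x == semimul d y) G (d, y).
Proof.
pose r := [seq p <- [seq (d, y) | d <- index_iota 1 n.+1, y <- D] |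
             x == semimul p.1 p.2].
rewrite (@fsbig_fwiden _ _ _ _ r); last first.
- move=> p [/= pr []]; move: pr; rewrite mem_filter => /andP [/eqP h].
  move=> /allpairsP [[d y] /= [h1 _ e]]; split=> //.
  by move: h1; rewrite e mem_index_iota => /andP [].
- apply: filter_uniq; apply: allpairs_uniq; rewrite ?iota_uniq //.
  by move=> [? ?] [? ?] _ _ /= [-> ->].
- move=> [d y] /= [d0 h]; rewrite mem_filter -h eqxx /=.
  have [h1 h2] := semimul_bounds d0 h.
  by apply/allpairsP; exists (d, y); rewrite mem_index_iota d0 ltnS.
rewrite big_filter big_mkcond big_allpairs_dep /=; apply: eq_bigr => d _.
by rewrite [RHS]big_mkcond.
Qed.

End MobiusInversion.

(** The index [m] stands for the power of the group element. It multiplies along with the degree, so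
    a pair [(d, e)] contributes [f (d * e) y] with [semimul (d * e) y = x], and the sum over [d]
    dividing [m = d * e] is a sum of Moebius values. *)
Lemma mobius_inversion (F : fieldType) (S : addSemigroupType)
    (f : nat -> S -> F) (W : nat -> S -> F) :
  finitely_decomposable S ->
  (forall m t, (0 < m)%N -> W m t =
     \sum_(p \in [set p : nat * S | (0 < p.1)%N /\ t = semimul p.1 p.2])
       p.1%:R^-1 * f (m * p.1)%N p.2) ->
  forall x, f 1%N x =
    \sum_(p \in [set p : nat * S | (0 < p.1)%N /\ x = semimul p.1 p.2])
      p.1%:R^-1 * (mobius p.1)%:~R * W p.1 p.2.
Proof.
move=> fd hW x; have [n [D [n0 uD hD]]] := decomposition_bounds fd x.
rewrite (fsbig_multiples uD hD).
(* The bounds for [x] also serve [t]: a decomposition of [t] followed by [d - 1] further copies of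
   [t] is one of [x]. *)
have WE d t : (0 < d)%N -> x = semimul d t -> W d t =
    \sum_(1 <= e < n.+1) \sum_(y <- D | t == semimul e y) e%:R^-1 * f (d * e)%N y.
  move=> d0 ht; rewrite hW // (@fsbig_multiples F S t n D) // => w hw.
  have hx : semisum (w ++ nseq d.-1 t) = Some x.
    rewrite semisum_cat hw semisum_nseq ht Some_semimul //.
    by case: (d) d0.
  have [h1 h2] := hD _ hx; split.
    by apply: leq_trans h1; rewrite size_cat leq_addr.
  by move=> y yw; apply: h2; rewrite mem_cat yw.
have muln_le d e y : (0 < d)%N -> (0 < e)%N -> x = semimul (d * e) y ->
    (d * e < n.+1)%N /\ y \in D.
  move=> d0 e0 h; rewrite ltnS; apply: (semimul_bounds hD) h.
  by rewrite muln_gt0 d0.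
(* Eliminates the intermediate degree [t], which is determined by [e] and [y] and automatically lies
   in [D]. *)
transitivity (\sum_(y <- D) \sum_(1 <= d < n.+1) \sum_(1 <= e < n.+1 | x == semimul (d * e) y)
    (d * e)%:R^-1 * (mobius d)%:~R * f (d * e)%N y); last first.
  rewrite exchange_big /=; apply: eq_big_nat => d /andP [d0 dn].
  transitivity (\sum_(t <- D | x == semimul d t) \sum_(1 <= e < n.+1)
      \sum_(y <- D | t == semimul e y)
    (d * e)%:R^-1 * (mobius d)%:~R * f (d * e)%N y); last first.
    apply: eq_bigr => t /eqP ht; rewrite WE // mulr_sumr; apply: eq_bigr => e _.
    rewrite mulr_sumr; apply: eq_bigr => y _.
    by rewrite natrM invfM; ring.
  transitivity (\sum_(1 <= e < n.+1) \sum_(y <- D)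
      \sum_(t <- D | (x == semimul d t) && (t == semimul e y))
      (d * e)%:R^-1 * (mobius d)%:~R * f (d * e)%N y); last first.
    rewrite [RHS]exchange_big /=; apply: eq_bigr => e _.
    by rewrite [RHS](exchange_big_dep xpredT).
  rewrite (exchange_big_dep xpredT) //=; apply: eq_big_nat => e /andP [e0 en].
  rewrite big_mkcond; apply: eq_big_seq => y yD.
  case: eqP => [h|h]; last first.
    rewrite big1 // => t /andP [/eqP h1 /eqP h2].
    by case: h; rewrite h1 h2 semimulM.
  have tD : semimul e y \in D.
    by apply: (semimul_bounds hD d0 _).2; rewrite semimulM.
  rewrite big_mkcond (bigD1_seq _ tD uD) /= eqxx andbT semimulM // -h eqxx.
  by rewrite big1 ?addr0 // => t /negbTE ->; rewrite andbF.
(* Collects the pairs [(d, e)] with the same product [m]; such an [m] is again at most [n]. *)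
transitivity (\sum_(y <- D) \sum_(1 <= m < n.+1 | x == semimul m y)
    \sum_(1 <= d < n.+1 | (d %| m)%N) m%:R^-1 * (mobius d)%:~R * f m y); last first.
  apply: eq_big_seq => y yD.
  transitivity (\sum_(1 <= m < n.+1) \sum_(1 <= d < n.+1) \sum_(1 <= e < n.+1 |
      (x == semimul m y) && (m == d * e)%N) m%:R^-1 * (mobius d)%:~R * f m y).
    rewrite big_mkcond; apply: eq_big_nat => m /andP [m0 mn].
    case: ifP => _ /=; last by rewrite big1 // => d _; rewrite big_pred0.
    rewrite big_mkcond; apply: eq_big_nat => d /andP [d0 dn].
    case: (boolP (d %| m)%N) => [dm|ndm]; last first.
      rewrite big1 // => e /eqP me.
      by rewrite me dvdn_mulr in ndm.
    have md : (m %/ d)%N \in index_iota 1 n.+1.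
      rewrite mem_index_iota divn_gt0 // (dvdn_leq m0 dm) /=.
      by apply: leq_ltn_trans mn; apply: leq_div.
    rewrite big_mkcond (bigD1_seq _ md (iota_uniq _ _)) /= mulnC divnK // eqxx.
    rewrite big1 ?addr0 // => e /negP he; case: eqP => // me; case: he.
    by rewrite me mulKn.
  rewrite exchange_big; apply: eq_big_nat => d /andP [d0 dn].
  rewrite /= (exchange_big_dep xpredT) //= [RHS]big_mkcond; apply: eq_big_nat => e /andP [e0 en] /=.
  case: eqP => [h|h]; last first.
    rewrite big1_seq // => m /andP [/andP [/eqP h1 /eqP h2] _].
    by case: h; rewrite -h2.
  have [den _] := muln_le d e y d0 e0 h.
  have dei : (d * e)%N \in index_iota 1 n.+1 by rewrite mem_index_iota muln_gt0 d0 e0.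
  rewrite big_mkcond (bigD1_seq _ dei (iota_uniq _ _)) /= -h !eqxx.
  by rewrite big1 ?addr0 // => m /negbTE ->; rewrite andbF.
have xD : x \in D by have [_ h] := hD [:: x] erefl; apply: h; rewrite mem_head.
have div m y : (0 < m < n.+1)%N ->
    \sum_(1 <= d < n.+1 | (d %| m)%N) m%:R^-1 * (mobius d)%:~R * f m y =
    (m == 1%N)%:R * f 1%N y.
  move=> /andP [m0 mn].
  transitivity (\sum_(d <- divisors m) m%:R^-1 * (mobius d)%:~R * f m y).
    rewrite -big_filter; apply: perm_big; apply: uniq_perm.
    - by apply: filter_uniq; apply: iota_uniq.
    - exact: divisors_uniq.
    move=> d; rewrite mem_filter mem_index_iota -dvdn_divisors //.
    case: (boolP (d %| m)%N) => //= dm; rewrite (dvdn_gt0 m0 dm).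
    by apply: leq_ltn_trans mn; apply: dvdn_leq.
  rewrite -mulr_suml -mulr_sumr.
  have -> : \sum_(d <- divisors m) (mobius d)%:~R = ((m == 1%N)%:R : F).
    by rewrite -(rmorph_sum (intr : int -> F)) sum_mobius // rmorph_nat.
  by case: eqP => [->|_]; rewrite ?invr1 ?mul1r // mulr0 !mul0r.
rewrite (bigD1_seq x xD uD) /= [X in _ + X]big1_seq => [|y /andP [yx yD]].
  rewrite addr0 big_mkcond (bigD1_seq 1%N) ?iota_uniq ?mem_index_iota //=.
  rewrite semimul1 eqxx div ?n0 // eqxx mul1r big1_seq ?addr0 // => m /andP [m1].
  rewrite mem_index_iota => hm; case: ifP => // _.
  by rewrite div // (negbTE m1) mul0r.
rewrite big1_seq // => m /andP [/eqP hm]; rewrite mem_index_iota => hm'.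
rewrite div //; case: eqP => [m1|_]; last by rewrite mul0r.
by move: yx; rewrite hm m1 semimul1 eqxx.
Qed.

(** * Triangular bases and conclusion *)

Section Triangular.
Variable C : numClosedFieldType.

Lemma trig_mulmx n (S T : 'M[C]_n) : is_trig_mx S -> is_trig_mx T ->
  is_trig_mx (S *m T) /\ forall i, (S *m T) i i = S i i * T i i.
Proof.
move=> /is_trig_mxP hS /is_trig_mxP hT; split.
  apply/is_trig_mxP => i j ij; rewrite mxE big1 // => k _.
  case: (ltnP i k) => [/hS ->|ki]; first by rewrite mul0r.
  by rewrite hT ?mulr0 //; apply: leq_ltn_trans ij.
move=> i; rewrite mxE (bigD1 i) //= big1 ?addr0 // => k ki.
case: (ltngtP i k) => [/hS ->|/hT ->|/ord_inj e]; rewrite ?mul0r ?mulr0 //.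
by rewrite e eqxx in ki.
Qed.

Lemma trig_expmx n (T : 'M[C]_n) d : is_trig_mx T ->
  is_trig_mx (iter d (mulmx T) 1%:M) /\
  forall i, (iter d (mulmx T) 1%:M) i i = T i i ^+ d.
Proof.
move=> hT; elim: d => [|d [IH1 IH2]] /=.
  split=> [|i]; last by rewrite mxE eqxx.
  by apply/is_trig_mxP => i j ij; rewrite mxE -val_eqE /= ltn_eqF.
have [h1 h2] := trig_mulmx hT IH1; split=> // i.
by rewrite h2 IH2 exprS.
Qed.

Variable (L : lmodType C).

Lemma set0_eq (u v : L) : [set 0] (u - v) <-> u = v.
Proof.
split=> [/= h|->]; last by rewrite /= subrr.
by apply/eqP; rewrite -subr_eq0; apply/eqP.
Qed.

Lemma finite_dimensional_quotient_fin (X : set L) :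
  finite_dimensional X -> quotient_fin X [set 0].
Proof.
move=> [s ->]; exists (size s), (fun i => s`_i).
pose Y := [set v | exists c : 'rV[C]_(size s), v = lincomb c (fun i => s`_i)].
have hY : submodule Y.
  split; first by exists 0; rewrite lincomb0.
  move=> c u v [cu ->] [cv ->]; exists (c *: cu + cv).
  by rewrite lincombP.
move=> v hv; suff [c ->] : Y v by exists c; apply/set0_eq.
apply: (span_subP hY _ hv) => u /= us.
have iu : (index u s < size s)%N by rewrite index_mem.
by exists (delta_mx 0 (Ordinal iu)); rewrite lincomb_delta /= nth_index.
Qed.

(** Over an algebraically closed field the matrix of [f] in some basis is conjugate to a triangular
    one; the conjugating matrix gives the new basis. *)
Lemma triangular_basis (X : set L) (f : {linear L -> L}) : submodule X ->
  finite_dimensional X -> (forall v, X v -> X (f v)) ->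
  exists n (z : 'I_n -> L) (T : 'M[C]_n), [/\ quotient_basis X [set 0] z,
    forall i, f (z i) = lincomb (row i T) z & is_trig_mx T].
Proof.
move=> hX /finite_dimensional_quotient_fin hfin hf.
have h0 := submodule_set0 L.
have [n [z hz]] := quotient_basis_ex hX h0 hfin.
have /choice [M hM] : forall i, exists c : 'rV[C]_n, f (z i) = lincomb c z.
  by move=> i; have [c [/set0_eq hc _]] := hz.2 _ (hf _ (hz.1 i)); exists c.
(* Simultaneous triangularization of a commuting family, here consisting of a single matrix. *)
have [P /unitarymx_unit Pu] := @cotrigonalization C n [:: \matrix_i M i]
  (fun A B hA hB => ltac:(by move: hA hB; rewrite !inE => /eqP -> /eqP ->)).
rewrite /= andbT /similar_to conjumx // => trigT.
set T := P *m _ *m _ in trigT.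
pose z' i := lincomb (row i P) z.
have zz' c : lincomb c z' = lincomb (c *m P) z.
  by apply/set0_eq; apply: lincomb_mul => // i; apply/set0_eq.
exists n, z', T; split=> //.
- apply: quotient_freeP => //.
  + move=> c; rewrite zz' => /(quotient_basis_free hX h0 hz) h.
    by rewrite -[c](mulmxK Pu) h mul0mx.
  + move=> i; apply: submodule_sum => // j _; apply: submoduleZ => //; exact: hz.1.
  + move=> v /hz.2 [c [/set0_eq hc _]]; exists (c *m invmx P).
    by apply/set0_eq; rewrite zz' mulmxKV.
- move=> i; rewrite zz' /z' lincomb_linear.
  rewrite -row_mul /T mulmxKV // row_mul.
  apply/set0_eq; apply: lincomb_mul => // j; apply/set0_eq.
  by rewrite rowK hM.
Qed.

(** One triangular basis computes the traces of all powers, since diagonal entries of triangular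
    matrices multiply. *)
Lemma is_trace_iter (X : set L) (f : {linear L -> L}) n (z : 'I_n -> L)
    (T : 'M[C]_n) d : quotient_basis X [set 0] z ->
  (forall i, f (z i) = lincomb (row i T) z) -> is_trig_mx T ->
  is_trace X [set 0] (iter d f) (\sum_i T i i ^+ d).
Proof.
move=> hz hf hT; apply/is_traceE; exists n, z, (iter d (mulmx T) 1%:M); split=> //.
  move=> i; apply/set0_eq; elim: d i => [|d IH] i /=.
    by rewrite row1 lincomb_delta.
  rewrite -iterS iterSr hf.
  have -> c : iter d f (lincomb c z) = lincomb c (fun i => iter d f (z i)).
    by elim: (d) => [//|m IHm] /=; rewrite IHm lincomb_linear.
  rewrite row_mul; apply/set0_eq; apply: lincomb_mul; first exact: submodule_set0.
  by move=> j; apply/set0_eq.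
by rewrite /mxtrace; apply: eq_bigr => i _; rewrite (trig_expmx d hT).2.
Qed.

End Triangular.

Section Assembly.
Variables (C : numClosedFieldType) (Gamma : addSemigroupType) (A : zmodType).
Variable theta : A -> A -> C.
Local Notation degree := (Gamma * A)%type.
Variables (L : lmodType C) (Lc : degree -> set L) (br : {bilinear L -> L -> L}).
Hypothesis theta_coloring : coloring theta.
Hypothesis fd : finitely_decomposable degree.
Hypothesis Lie : color_lie_superalgebra theta Lc br.
Hypothesis Lc_fin : forall x, finite_dimensional (Lc x).

Lemma closed_natr_neq0 r : r.+1%:R != 0 :> C.
Proof. by rewrite pnatr_eq0. Qed.

(** The map [psi] is multiplicative because the cross terms [theta a b * theta b a] are 1. *)
Lemma psi_semisum (w : seq degree) x : semisum w = Some x ->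
  psi theta x.2 = \prod_(y <- w) psi theta y.2.
Proof.
elim: w x => [//|y w IH] x; rewrite big_cons semisum_cons.
case E : (semisum w) => [z|] /= [<-]; last first.
  by case: w E {IH} => //; rewrite big_nil mulr1.
rewrite -(IH _ E) /psi (coloringDl theta_coloring) !(coloringDr theta_coloring).
have := coloring_skew theta_coloring y.2 z.2.
set a := theta y.2 z.2; set b := theta z.2 y.2 => ab.
by transitivity (theta y.2 y.2 * theta z.2 z.2 * (a * b)); [ring | rewrite ab mulr1].
Qed.

Section Action.
Variable f : {linear L -> L}.
Hypothesis f_br : forall u v, f (br u v) = br (f u) (f v).
Hypothesis f_Lc : forall x u, Lc x u -> Lc x (f u).

Section Letters.
Variables (x : degree) (n : nat) (D : seq degree).
Hypothesis n0 : (0 < n)%N.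
Hypothesis uD : uniq D.
Hypothesis bounds : forall w : seq degree, semisum w = Some x ->
  (size w <= n)%N /\ {subset w <= D}.

Variables (I : finType) (deg : I -> degree) (vec : I -> L) (coord : I -> L -> C)
  (ht : I -> nat).
Hypothesis vec_deg : forall i, Lc (deg i) (vec i).
Hypothesis coord_vec : forall i j, deg i = deg j -> coord i (vec j) = (i == j)%:R.
Hypothesis coord_linear : forall i c u v, Lc (deg i) u -> Lc (deg i) v ->
  coord i (c *: u + v) = c * coord i u + coord i v.
Hypothesis coord_span : forall y u, y \in D -> Lc y u ->
  u = \sum_(i | deg i == y) coord i u *: vec i.
Hypothesis f_triangular : forall i j, deg i = deg j ->
  coord i (f (vec j)) != 0 -> i = j \/ (ht i < ht j)%N.
Hypothesis str_iter : forall y d, y \in D ->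
  trace (Lc y) [set 0] (iter d f) = \sum_(i | deg i == y) coord i (f (vec i)) ^+ d.

Local Notation lam i := (coord i (f (vec i))).
Local Notation ev := (even theta deg).

(** Transfers the bounds [n] and [D] from [x] to the degrees occurring in its decompositions. *)
Lemma semisum_extend w y : semisum w = Some x -> y \in w ->
  forall s, semisum s = Some y -> exists t, semisum (s ++ t) = Some x.
Proof.
move=> hw yw s hs; exists (rem y w); rewrite semisum_cat hs -semisum_cons -hw.
by apply/esym/semisum_perm/perm_to_rem.
Qed.

(** Up to sign, the supertrace on homology is a coefficient of the Euler product. A monomial with
    [k] letters enters with sign [(-1) ^+ k.+1] and with [psi] of its degree, the product of the
    signs of its letters; both are absorbed by [- sgn ev i], leaving one global minus sign. *)
Lemma str_homology_monomials w y : semisum w = Some x -> y \in w ->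
  str_homology theta Lc br f y =
  - \sum_(e : {ffun I -> 'I_n.+1} |
           [forall i, ev i ==> (e i <= 1)%N] && (monomial_degree deg e == Some y))
      \prod_i (- sgn ev i * lam i) ^+ e i.
Proof.
move=> hw yw.
have ext s : semisum s = Some y -> (size s <= n)%N /\ {subset s <= D}.
  move=> hs; have [t ht'] := semisum_extend hw yw hs.
  have [h1 h2] := bounds ht'; split.
    by apply: leq_trans h1; rewrite size_cat leq_addr.
  by move=> z zs; apply: h2; rewrite mem_cat zs.
have size_le s : semisum s = Some y -> (size s <= n)%N by case/ext.
have tr k := is_trace_chains (closed_natr_neq0 1) theta_coloring Lie vec_deg coord_vec
  coord_linear size_le (fun s hs z u zs => coord_span ((ext s hs).2 z zs)) f_Lc f_triangular k.
rewrite (str_homology_chains theta_coloring Lie f_br f_Lc (n := n) _ tr); last first.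
  by move=> v /size_le; rewrite size_map.
have degE (e : {ffun I -> 'I_n.+1}) : exponent_degree deg e = monomial_degree deg e.
  by rewrite /exponent_degree semisumE big_map big_nf.
rewrite mulr_sumr.
under eq_bigr do rewrite mulrA mulr_sumr.
pose cond (e : {ffun I -> 'I_n.+1}) :=
  [forall i, ev i ==> (e i <= 1)%N] && (monomial_degree deg e == Some y).
rewrite (exchange_big_dep cond) /=; last first.
  by move=> k e _; rewrite inE => /and3P [h1 _ h2]; rewrite /cond -degE h2 andbT.
rewrite -sumrN; apply: eq_bigr => e /andP [ae /eqP de].
pose k := (\sum_i e i)%N.
have sy : semisum [seq deg i | i <- nf e] = Some y by rewrite -[LHS]degE in de *.
have kin : k \in index_iota 1 n.+1.
  have := size_le _ sy; rewrite size_map size_nf mem_index_iota -/k ltnS => ->.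
  rewrite andbT lt0n; apply: contra_eqN sy; rewrite /k -size_nf => /nilP ->.
  by [].
rewrite big_mkcond (bigD1_seq k kin (iota_uniq _ _)) /= [X in _ + X]big1 ?addr0; last first.
  move=> k' k'k; rewrite inE -/k [k == _]eq_sym (negbTE k'k) andbF.
  by [].
rewrite inE -/k eqxx (ae : admissible theta deg e) degE de eqxx /=.
have -> : \prod_i (- sgn ev i * lam i) ^+ e i =
  (-1) ^+ k * (\prod_i sgn ev i ^+ e i) * \prod_i lam i ^+ e i.
  rewrite /k -prodrXr -!big_split; apply: eq_bigr => i _ /=.
  by rewrite -[- sgn _ _]mulN1r !exprMn.
have -> : psi theta y.2 = \prod_i sgn ev i ^+ e i.
  rewrite (psi_semisum sy) big_map big_nf; apply: eq_bigr => i _.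
  rewrite (psi_even theta_coloring) Monoid.iteropE /sgn.
  by elim: (nat_of_ord _) => [//|m IH]; rewrite exprS /= IH.
by rewrite exprS; ring.
Qed.

Lemma witt_letters : witt theta Lc br f x =
  \sum_(p \in [set p : nat * degree | (0 < p.1)%N /\ x = semimul p.1 p.2])
     p.1%:R^-1 * str theta p.2 (Lc p.2) [set 0] (iter p.1 f).
Proof.
rewrite /witt witt_partition_words; [|exact: closed_natr_neq0|exact: fd].
have size_le w : semisum w = Some x -> (size w <= n)%N by case/bounds.
rewrite (log_words_euler closed_natr_neq0 (lam := fun i => lam i) (deg := deg)
   (even := ev) size_le n0); last first.
  by move=> w hw y yw; apply: str_homology_monomials hw yw.
rewrite (fsbig_multiples uD bounds) big_add1 succnK big_mkord.
apply: eq_bigr => d _.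
transitivity (d.+1%:R^-1 * \sum_(y <- D | x == semimul d.+1 y)
  str theta y (Lc y) [set 0] (iter d.+1 f)); last by rewrite mulr_sumr.
congr (_ * _).
transitivity (\sum_(y <- D) \sum_(i | deg i == y)
  sgn ev i * lam i ^+ d.+1 * (x == semimul d.+1 y)%:R).
  rewrite (exchange_big_dep xpredT) //; apply: eq_bigr => i _.
  have -> : iterop d.+1 oadd (Some (deg i)) None = Some (semimul d.+1 (deg i)).
    by rewrite Monoid.iteropE Some_semimul.
  rewrite (inj_eq Some_inj) eq_sym; case: (eqVneq x (semimul d.+1 (deg i))) => [h|h].
    have iD := (semimul_bounds bounds (ltn0Sn d) h).2.
    rewrite big_mkcond (bigD1_seq _ iD uD) /= eqxx -h eqxx.
    by rewrite big1 ?addr0 // => y; rewrite eq_sym => /negbTE ->.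
  by rewrite mulr0 big1 // => y /eqP <-; rewrite (negbTE h) mulr0.
rewrite [RHS]big_mkcond; apply: eq_big_seq => y yD.
rewrite /str str_iter //; case: eqP => _; last by rewrite big1 // => i _; rewrite mulr0.
rewrite mulr_sumr; apply: eq_bigr => i /eqP <-.
by rewrite mulr1 (psi_even theta_coloring).
Qed.

End Letters.

Lemma triangular_letters (D : seq degree) : exists (I : finType) (deg : I -> degree)
    (vec : I -> L) (coord : I -> L -> C) (ht : I -> nat),
  [/\ forall i, Lc (deg i) (vec i),
      forall i j, deg i = deg j -> coord i (vec j) = (i == j)%:R,
      forall i c u v, Lc (deg i) u -> Lc (deg i) v ->
        coord i (c *: u + v) = c * coord i u + coord i v,
      forall y u, y \in D -> Lc y u -> u = \sum_(i | deg i == y) coord i u *: vec i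
    & (forall i j, deg i = deg j -> coord i (f (vec j)) != 0 ->
         i = j \/ (ht i < ht j)%N) /\
      forall y d, y \in D ->
        is_trace (Lc y) [set 0] (iter d f) (\sum_(i | deg i == y) coord i (f (vec i)) ^+ d)].
Proof.
have hS y := LcS Lie y; have h0 := submodule_set0 L.
have /choice [b hb] : forall y, exists b : {n : nat & (('I_n -> L) * 'M[C]_n)%type},
    [/\ quotient_basis (Lc y) [set 0] (projT2 b).1,
        forall i, f ((projT2 b).1 i) = lincomb (row i (projT2 b).2) (projT2 b).1
      & is_trig_mx (projT2 b).2].
  move=> y; have [n [z [T h]]] := triangular_basis (hS y) (Lc_fin y) (@f_Lc y).
  by exists (existT _ n (z, T)).
pose N y := projT1 (b y); pose z y : 'I_(N y) -> L := (projT2 (b y)).1.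
pose T y : 'M[C]_(N y) := (projT2 (b y)).2.
have hz y : quotient_basis (Lc y) [set 0] (z y) by case: (hb y).
have fz y i : f (z y i) = lincomb (row i (T y)) (z y) by have [_ h _] := hb y; apply: h.
have trigT y : is_trig_mx (T y) by case: (hb y).
have zL y c : Lc y (lincomb c (z y)).
  apply: (submodule_sum (hS y)) => i _; apply: (submoduleZ (hS y)).
  exact: (hz y).1.
(* The letters are the triangular basis vectors of the components with degree in [D], a finite set;
   the position in the basis will be the height. *)
pose I : finType := {a : seq_sub D & 'I_(N (ssval a))}.
pose deg (i : I) := ssval (tag i).
pose vec (i : I) := z (deg i) (tagged i).
(* Coordinates are prescribed only on the component of the letter; elsewhere the chosen value is
   arbitrary. *)
have /choice [co hco] : forall p : I * L, exists a : C, Lc (deg p.1) p.2 ->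
    exists2 c : 'rV_(N (deg p.1)), p.2 = lincomb c (z _) & a = c 0 (tagged p.1).
  move=> [i u]; have [hu|nu] := pselect (Lc (deg i) u); last by exists 0 => /nu.
  have [c [/set0_eq hc _]] := (hz (deg i)).2 _ hu.
  by exists (c 0 (tagged i)) => _; exists c.
pose coord i u := co (i, u).
have coE i c : coord i (lincomb c (z (deg i))) = c 0 (tagged i).
  have [c' e] := hco (i, lincomb c (z (deg i))) (zL _ _).
  move: e => /= e; rewrite /coord => ->; suff -> : c' = c by [].
  apply/eqP; rewrite -subr_eq0; apply/eqP.
  by apply: (quotient_basis_free (hS _) h0 (hz (deg i))); rewrite lincombB -e /= subrr.
(* Puts two letters of equal degree over the same index, so that their positions are comparable in
   one ordinal type. *)
have tagE (i j : I) : deg i = deg j ->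
    exists k, j = Tagged (fun a => 'I_(N (ssval a))) (k : 'I_(N (ssval (tag i)))).
  case: i j => [a i] [a' j] h; have e : a = a' by apply: val_inj.
  by subst a'; exists j.
have vecE (i : I) k :
    vec (Tagged (fun a => 'I_(N (ssval a))) (k : 'I_(N (ssval (tag i))))) = z (deg i) k.
  by [].
exists I, deg, vec, coord, (fun i : I => nat_of_ord (tagged i)); split.
- by move=> i; apply: (hz _).1.
- move=> i j e; have [k ->] := tagE _ _ e.
  rewrite vecE -[z _ k]lincomb_delta coE mxE eqxx /=.
  by case: (i) k => a i' k; rewrite eq_Tagged eq_sym.
- move=> i c u v hu hv.
  have [cu [/set0_eq -> _]] := (hz _).2 _ hu; have [cv [/set0_eq -> _]] := (hz _).2 _ hv.
  by rewrite -lincombP !coE !mxE.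
- move=> y u yD hu; have [c [/set0_eq -> _]] := (hz y).2 _ hu.
  pose a : seq_sub D := SeqSub yD.
  transitivity (\sum_(a' : seq_sub D | ssval a' == y) \sum_(i : 'I_(N (ssval a')))
      coord (Tagged (fun a => 'I_(N (ssval a))) i) (lincomb c (z y)) *: z (ssval a') i).
    rewrite (big_pred1 a) => [|a']; last by rewrite [RHS]/= -(inj_eq val_inj).
    apply: eq_bigr => i _.
    by rewrite (coE (Tagged (fun a => 'I_(N (ssval a))) (i : 'I_(N (ssval a))))).
  rewrite (sig_big_dep (fun a' : seq_sub D => ssval a' == y) (fun _ => xpredT)).
  by apply: eq_big => [i|i _]; rewrite ?andbT //; case: i.
- have fE (i : I) (k : 'I_(N (ssval (tag i)))) :
      coord i (f (vec (Tagged (fun a => 'I_(N (ssval a))) k))) = T (deg i) k (tagged i).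
    by rewrite vecE fz coE mxE.
  split=> [i j e|y d yD].
    have [k ->] := tagE _ _ e; rewrite fE => hT.
    have /= := leqNgt (tagged i) k; case: ltnP => [lt|le] _.
      by move/is_trig_mxP: (trigT (deg i)) => h; rewrite h ?eqxx in hT.
    case: (ltngtP (tagged i) k) le => // [lt _|/ord_inj <- _]; first by right.
    by left; case: (i).
  pose a : seq_sub D := SeqSub yD.
  suff -> : \sum_(i | deg i == y) coord i (f (vec i)) ^+ d = \sum_k T y k k ^+ d.
    exact: is_trace_iter (hz y) (fz y) (trigT y).
  transitivity (\sum_(a' : seq_sub D | ssval a' == y) \sum_(i : 'I_(N (ssval a')))
      T (ssval a') i i ^+ d).
    rewrite (sig_big_dep (fun a' : seq_sub D => ssval a' == y) (fun _ => xpredT)).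
    apply: eq_big => [i|i _]; first by rewrite andbT.
    by case: i => a' i; rewrite (fE (Tagged (fun a => 'I_(N (ssval a))) i) i).
  by rewrite (big_pred1 a) => [|a']; last by rewrite [RHS]/= -(inj_eq val_inj).
Qed.

Lemma witt_str x : witt theta Lc br f x =
  \sum_(p \in [set p : nat * degree | (0 < p.1)%N /\ x = semimul p.1 p.2])
     p.1%:R^-1 * str theta p.2 (Lc p.2) [set 0] (iter p.1 f).
Proof.
have [n [D [n0 uD hD]]] := decomposition_bounds fd x.
have [I [deg [vec [coord [ht [h1 h2 h3 h4 [h5 h6]]]]]]] := triangular_letters D.
apply: (witt_letters n0 uD hD h1 h2 h3 h4 h5) => y d yD.
(* Uniqueness of traces is stated for linear maps, so the iterate needs its linear structure. *)
have lin : linear (iter d f).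
  by move=> c u v; elim: d => [//|d IH] /=; rewrite IH linearP.
pose iter_f : {linear L -> L} :=
  HB.pack (iter d f) (GRing.isLinear.Build C L L *:%R (iter d f) lin).
apply: (is_trace_trace (f := iter_f)); [exact: (LcS Lie)|exact: submodule_set0| |exact: h6].
by move=> v ->; apply: (linear0 iter_f).
Qed.

End Action.
End Assembly.

Theorem theorem2p4 (R : realType) (Gamma : addSemigroupType) (A : zmodType)
  (theta : A -> A -> R[i])
  (L : lmodType R[i]) (Lc : Gamma * A -> set L) (br : {bilinear L -> L -> L})
  (G : groupType) (rho : G -> {linear L -> L}) :
  countable [set: Gamma] -> countable [set: A] ->
  coloring theta ->
  finitely_decomposable (Gamma * A)%type ->
  color_lie_superalgebra theta Lc br ->
  (forall x, finite_dimensional (Lc x)) ->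
  graded_action Lc br rho ->
  forall (g : G) (x : Gamma * A),
    str theta x (Lc x) [set 0] (rho g) =
    \sum_(p \in [set p : nat * (Gamma * A) |
                  (0 < p.1)%N /\ x = semimul p.1 p.2])
       p.1%:R^-1 * (mobius p.1)%:~R * witt theta Lc br (rho (g ^+ p.1)%g) p.2.
Proof.
move=> _ _ hcol fd Lie Lc_fin [rho1 rhoM rho_br rho_Lc] g x.
have iter_rho h d : iter d (rho h) = rho (h ^+ d)%g.
  apply/funext => u; elim: d => [|d IH] /=; first by rewrite expg0 rho1.
  by rewrite IH -rhoM expgS.
rewrite -{1}[g]expg1.
(* The hypothesis of the inversion at [m] is [witt_str] for [g ^+ m], whose [d]-th iterate is the
   action of [g ^+ (m * d)]. *)
apply: (mobius_inversion (f := fun m y => str theta y (Lc y) [set 0] (rho (g ^+ m)%g))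
  (W := fun m => witt theta Lc br (rho (g ^+ m)%g)) fd) => m t _; rewrite (witt_str hcol fd Lie Lc_fin (rho_br _) (rho_Lc _)).
by apply: eq_fsbigr => p _; rewrite iter_rho expgnA.
Qed.
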